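(* Let $T>0$ and suppose that $u$, the solution of the periodic initial-value problem for the KdV equation $$u_t+uu_x+u_{xxx}=0,\quad x\in[-\pi,\pi],\ 0\le t\le T,\qquad u(x,0)=u_0(x),$$ belongs to $H^{\mu}$ for $t\in[0,T]$. For each integer $N\ge 1$ let $u^N$ be the Fourier-Galerkin semidiscrete approximation of $u$ in $S_N$ (defined in the context). Let $j$ and $l$ be nonnegative integers, and suppose $\mu\ge\max\{2,3j+l+1\}$. Then there exists a constant $C$ independent of $N$ such that $$\max_{0\le t\le T}\|\partial_t^j u^N(t)\|_l\le C.$$
   Context: All functions of $x$ are $2\pi$-periodic; $u_0$ is real-valued. $L^2=L^2(-\pi,\pi)$ has inner product $(v,w)=\int_{-\pi}^{\pi}v\overline{w}\,dx$ and norm $\|\cdot\|$. For real $\mu\ge 0$, $H^{\mu}$ is the $L^2$-based Sobolev space of periodic functions on $(-\pi,\pi)$ with norm $\|g\|_{\mu}=\left(\sum_{k\in\mathbb{Z}}(1+k^2)^{\mu}|\widehat g(k)|^2\right)^{1/2}$, where $\widehat g(k)=\frac1{2\pi}\int_{-\pi}^{\pi}e^{-ikx}g(x)\,dx$. ''The solution $u$ belongs to $H^\mu$ for $t\in[0,T]$'' means that $u_0\in H^\mu$ and $u\in C([0,T];H^{\mu})$ is the (unique, real-valued) solution of the initial-value problem, the equation being understood in $H^{\mu-3}$. For an integer $N\ge1$, $S_N=\mathrm{span}\{e^{ikx}: k\in\mathbb{Z},\ -N\le k\le N\}$, and $P_N$ is the $L^2$-projection onto $S_N$, $P_Nv=\sum_{|k|\le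 N}\widehat v(k)e^{ikx}$. The semidiscrete Fourier-Galerkin approximation is the real-valued map $u^N:[0,T]\to S_N$ satisfying $(u^N_t+u^Nu^N_x+u^N_{xxx},\chi)=0$ for all $\chi\in S_N$, $0\le t\le T$, and $u^N(0)=P_Nu_0$; it exists uniquely on $[0,T]$. *)

(* Defs.v *)
From HB Require Import structures.
From mathcomp Require Export all_boot all_order all_algebra.
From mathcomp Require Export all_classical all_reals all_analysis.
From mathcomp.real_closed Require Export complex.

Set Implicit Arguments.
Unset Strict Implicit.
Unset Printing Implicit Defensive.

Import Order.TTheory GRing.Theory Num.Theory.
Import numFieldNormedType.Exports.

Local Open Scope classical_set_scope.
Local Open Scope complex_scope.
Local Open Scope ring_scope.

Section Periodic.
Variable R : realType.
Implicit Types (g v w : R -> R[i]) (c : int -> R[i]) (k : int).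

Definition Ipi : set R := `[- pi, pi].

Definition periodic v := forall x, v (x + pi *+ 2) = v x.

Definition cintegral g : R[i] :=
  (\int[lebesgue_measure]_(x in Ipi) complex.Re (g x)) +i*
  (\int[lebesgue_measure]_(x in Ipi) complex.Im (g x)).

Definition L2 g :=
  [/\ measurable_fun Ipi (fun x => complex.Re (g x)),
      measurable_fun Ipi (fun x => complex.Im (g x)) &
      (\int[lebesgue_measure]_(x in Ipi)
         ((Normc.normc (g x)) ^+ 2)%:E < +oo)%E].

Definition inner v w : R[i] := cintegral (fun x => v x * conjc (w x)).

(* e^{ikx} *)
Definition expik k (x : R) : R[i] :=
  cos (k%:~R * x) +i* sin (k%:~R * x).

Definition fourier_coef g k : R[i] :=
  ((pi *+ 2)^-1)%:C * cintegral (fun x => expik (- k) x * g x).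

(* The norm of H^s acts on sequences of Fourier coefficients, so that it makes
   sense for every real s: for s < 0 the elements of H^s are periodic
   distributions, which we represent by their Fourier coefficients. *)
Definition Hs_norm (s : R) c : \bar R :=
  sqrte (\esum_(k in [set: int])
           ((1 + k%:~R ^+ 2) `^ s * Normc.normc (c k) ^+ 2)%:E)%E.

Definition sobolev_norm (s : R) g : \bar R := Hs_norm s (fourier_coef g).

Definition sobolev (s : R) g :=
  [/\ periodic g, L2 g & (sobolev_norm s g < +oo)%E].

(* d/dx on periodic distributions represented by their Fourier coefficients *)
Definition dxc c : int -> R[i] := fun k => (0 +i* k%:~R) * c k.

(* w is the weak derivative of v: testing against e^{ikx} for all k,
   (w, e^{ikx}) = - (v, (e^{ikx})') *)
Definition weak_dx v w :=
  L2 w /\ forall k, fourier_coef w k = dxc (fourier_coef v) k.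

(* The frequencies -N, ..., N *)
Definition freq (N : nat) (i : 'I_(N.*2.+1)) : int := i%:Z - N%:Z.

Definition SN (N : nat) g :=
  exists c : 'I_(N.*2.+1) -> R[i],
    g = fun x => \sum_i c i * expik (freq i) x.

Definition PN (N : nat) g : R -> R[i] :=
  fun x => \sum_(i < N.*2.+1) fourier_coef g (freq i) * expik (freq i) x.

End Periodic.

Section KdV.
Variable R : realType.
Implicit Types (T mu : R) (v : R -> R) (u : R -> R -> R).
(* In u : R -> R -> R the first argument is t and the second one is x; only
   the values at t in [0, T] are meaningful. *)

Definition rc v : R -> R[i] := fun x => (v x)%:C.

(* Punctured neighbourhoods of t in [0, T]: limits are one-sided at 0 and T *)
Definition tnear T (t : R) : set_system R := within `[0, T] t^'.

Definition dt T u : R -> R -> R := fun t x =>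
  lim ((s - t)^-1 * (u s x - u t x) @[s --> tnear T t]).

Definition t_derivable T u (t x : R) :=
  cvg ((s - t)^-1 * (u s x - u t x) @[s --> tnear T t]).

(* The distribution c, an element of H^s, is the derivative at t of the map
   u : [0, T] -> H^s *)
Definition Hs_dt (s : R) T u (t : R) (c : int -> R[i]) :=
  (Hs_norm s c < +oo)%E /\
  Hs_norm s (fun k => ((r - t)^-1)%:C *
      (fourier_coef (rc (u r)) k - fourier_coef (rc (u t)) k) - c k)
    @[r --> tnear T t] --> 0%E.

Definition kdv_solution mu T (u0 : R -> R) u :=
  [/\ sobolev mu (rc u0),
      (forall t : R, t \in `[0, T] -> sobolev mu (rc (u t))),
      (forall t : R, t \in `[0, T] ->
         sobolev_norm mu (rc (fun x => u s x - u t x))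
           @[s --> within `[0, T] (nbhs t)] --> 0%E),
      {ae lebesgue_measure, forall x, u 0 x = u0 x} &
      forall t : R, t \in `[0, T] ->
        exists (ut : int -> R[i]) (ux : R -> R),
          [/\ Hs_dt (mu - 3) T u t ut,
              weak_dx (rc (u t)) (rc ux) &
              forall k, ut k + fourier_coef (rc (fun x => u t x * ux x)) k
                        + dxc (dxc (dxc (fourier_coef (rc (u t))))) k = 0]].

Definition galerkin (N : nat) T (u0 : R -> R) u :=
  [/\ (forall t : R, t \in `[0, T] -> SN N (rc (u t))),
      (forall t x : R, t \in `[0, T] -> t_derivable T u t x),
      (forall (t : R) (chi : R -> R[i]), t \in `[0, T] -> SN N chi ->
         inner (rc (fun x => dt T u t x + u t x * derive1 (u t) x
                             + derive1n 3 (u t) x)) chi = 0) &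
      rc (u 0) = PN N (rc u0)].

End KdV.

(* Main.v *)
Require Import Defs.
From mathcomp Require Import measurable_realfun.
From mathcomp Require Import ring lra zify.

Set Implicit Arguments.
Unset Strict Implicit.
Unset Printing Implicit Defensive.

Import Order.TTheory GRing.Theory Num.Theory.
Import numFieldNormedType.Exports.
Local Open Scope classical_set_scope.
Local Open Scope complex_scope.
Local Open Scope ring_scope.

(** The argument is carried out on Fourier coefficients: [c t] stands for those
    of the exact solution [u], [a N t] for those of the approximation [u^N].

    The exact solution. A map continuous into [H^mu] on a compact interval is
    bounded there ([solution_bounded]). As [mu >= 2], the Fourier series of [u]
    and of [u_x] converge absolutely, and because an integrable function is
    determined by its coefficients ([fourier_unique]), [u] and [u_x] are almost
    everywhere the sums of these series. Hence the coefficients of [u u_x] are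
    the limits of the convolutions of the truncated coefficient sequences
    ([nonlinear_coef_cvg]), and the equation becomes an infinite system of
    ordinary differential equations for [c] ([solution_dt]), of which [a N]
    solves the truncation to frequencies at most [N] ([galerkin_coef]).

    The error. Let [th = a N - P_N c] and let [n] be a natural number with
    [2 <= n <= mu]. In the derivative of the square of the [L^2] norm of [th],
    the dispersive term drops out because it is skew-adjoint, [th th_x] drops
    out because [th^2 th_x] is a derivative, and the terms linear in [th] are
    integrated by parts, at the price of a uniform bound on [u_x]. What remains
    has a factor composed of the frequencies of [u] beyond [N], and is of order
    [N^(1 - n)] ([nonlinear_error], [high_frequencies]). By Gronwall's inequality
    so is [th] ([galerkin_error]). Since [th] is a trigonometric polynomial of
    degree [N], its [H^m] norm is at most about [N^m] times its [L^2] norm, so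
    that [u^N] is bounded in [H^m] for [m <= mu - 1], uniformly in [N]
    ([galerkin_sob_bounded]).

    Time derivatives. By its differential equation, a time derivative of [u^N] is
    a polynomial expression in [u^N]. A derivative in time costs three
    derivatives in space, the products being harmless because [H^s] is an algebra
    for [s >= 1] ([sob_conv], [flow_eval_bounded]); the bound in [H^(3 j + l)]
    thus yields the one on the [j]-th time derivative in [H^l].

    All estimates are made on sums over finitely many frequencies, with constants
    independent of their number. *)

(** * Finite sums over frequencies *)

(** A list rather than the index type of the basis of [SN]: sums are then
    restricted and reindexed by comparing lists up to permutation. *)
Definition zs (N : nat) : seq int := [seq freq i | i <- enum 'I_(N.*2.+1)].

Lemma mem_zs N (k : int) : (k \in zs N) = (absz k <= N)%N.
Proof.
apply/mapP/idP => [[i _ ->]|kN].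
  by rewrite /freq; have := ltn_ord i; lia.
have h : (absz (k + Posz N)%R < N.*2.+1)%N by lia.
exists (Ordinal h); first by rewrite mem_enum.
by rewrite /freq /=; lia.
Qed.

Lemma uniq_zs N : uniq (zs N).
Proof.
rewrite map_inj_uniq ?enum_uniq// => i j; rewrite /freq => h.
by apply/val_inj; move: h => /=; lia.
Qed.

Lemma sum_freq (V : nmodType) N (F : int -> V) :
  \sum_(i < N.*2.+1) F (freq i) = \sum_(k <- zs N) F k.
Proof. by rewrite /zs big_map big_enum. Qed.

Lemma perm_zsN N : perm_eq [seq - k | k <- zs N] (zs N).
Proof.
apply: uniq_perm; [by rewrite (map_inj_uniq oppr_inj) uniq_zs|exact: uniq_zs|].
move=> k; rewrite mem_zs; apply/mapP/idP => [[l]|kN].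
  by rewrite mem_zs => h ->; rewrite abszN.
by exists (- k); rewrite ?opprK// mem_zs abszN.
Qed.

Lemma sum_zsN (V : nmodType) N (F : int -> V) :
  \sum_(k <- zs N) F (- k) = \sum_(k <- zs N) F k.
Proof. by rewrite -(big_map -%R xpredT F) (perm_big _ (perm_zsN N)). Qed.

Definition cut (V : nmodType) N (c : int -> V) k : V :=
  if (absz k <= N)%N then c k else 0.

Lemma sum_cut (V : nmodType) N M (F : int -> V) : (N <= M)%N ->
  \sum_(k <- zs M) cut N F k = \sum_(k <- zs N) F k.
Proof.
move=> NM; rewrite -big_mkcond /= -big_filter; apply: perm_big.
apply: uniq_perm; rewrite ?filter_uniq ?uniq_zs// => k.
by rewrite mem_filter !mem_zs; lia.
Qed.

Lemma sum_pick (V : nmodType) M (j : int) (F : int -> V) :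
  \sum_(k <- zs M) F k *+ (k == j) = cut M F j.
Proof.
rewrite /cut -mem_zs; case: ifP => jM; last first.
  rewrite big_seq big1 // => k kM; case: eqP => // kj.
  by rewrite kj jM in kM.
by rewrite (bigD1_seq j)//= ?uniq_zs// eqxx big1 ?addr0// => k /negbTE ->.
Qed.

(** For [F p q r = f p * g q * h r] this is the mean value of the product of the
    trigonometric polynomials of degree [M] with coefficients [f], [g], [h]. *)
Definition tri (V : nmodType) M (F : int -> int -> int -> V) : V :=
  \sum_(p <- zs M) \sum_(q <- zs M) \sum_(r <- zs M)
    F p q r *+ (p + q + r == 0).

Lemma eq_tri (V : nmodType) {M} (F G : int -> int -> int -> V) :
  (forall p q r, p + q + r = 0 -> F p q r = G p q r) -> tri M F = tri M G.
Proof.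
move=> FG; apply: eq_bigr => p _; apply: eq_bigr => q _; apply: eq_bigr => r _.
by case: eqP => // /FG ->.
Qed.

Lemma tri_swap12 (V : nmodType) M (F : int -> int -> int -> V) :
  tri M F = tri M (fun p q r => F q p r).
Proof.
rewrite /tri exchange_big; apply: eq_bigr => p _; apply: eq_bigr => q _.
by apply: eq_bigr => r _; rewrite [q + p]addrC.
Qed.

Lemma tri_swap23 (V : nmodType) M (F : int -> int -> int -> V) :
  tri M F = tri M (fun p q r => F p r q).
Proof.
rewrite /tri; apply: eq_bigr => p _; rewrite exchange_big.
by apply: eq_bigr => q _; apply: eq_bigr => r _; rewrite addrAC.
Qed.

Lemma triD (V : nmodType) M (F G : int -> int -> int -> V) :
  tri M (fun p q r => F p q r + G p q r) = tri M F + tri M G.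
Proof.
rewrite /tri -big_split; apply: eq_bigr => p _; rewrite -big_split.
apply: eq_bigr => q _; rewrite -big_split; apply: eq_bigr => r _.
by rewrite mulrnDl.
Qed.

Lemma triZ (A : pzRingType) M (a : A) (F : int -> int -> int -> A) :
  tri M (fun p q r => a * F p q r) = a * tri M F.
Proof.
rewrite /tri mulr_sumr; apply: eq_bigr => p _; rewrite mulr_sumr.
apply: eq_bigr => q _; rewrite mulr_sumr; apply: eq_bigr => r _.
by rewrite mulrnAr.
Qed.

Lemma ler_tri (A : numDomainType) {M} (F G : int -> int -> int -> A) :
  (forall p q r, p + q + r = 0 -> F p q r <= G p q r) -> tri M F <= tri M G.
Proof.
move=> FG; apply: ler_sum => p _; apply: ler_sum => q _; apply: ler_sum => r _.
by case: eqP => // /FG.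
Qed.

Section Young.
Variable R : realFieldType.
Implicit Types al be ga : int -> R.

(** For given [p] and [q], a single [r] contributes. *)
Lemma tri_mid_le M al be : (forall k, 0 <= al k) -> (forall k, 0 <= be k) ->
  tri M (fun p q r => be q * al p) <=
  (\sum_(q <- zs M) be q) * \sum_(p <- zs M) al p.
Proof.
move=> al0 be0; rewrite /tri exchange_big mulr_suml; apply: ler_sum => q _.
rewrite mulr_sumr; apply: ler_sum => p _.
have -> : \sum_(r <- zs M) (be q * al p) *+ (p + q + r == 0) =
          cut M (fun=> be q * al p) (- (p + q)).
  by rewrite -sum_pick; apply: eq_bigr => r _; congr (_ *+ nat_of_bool _); lia.
by rewrite /cut; case: ifP => // _; rewrite mulr_ge0.
Qed.

(** The trilinear form of Young's inequality [l^2 * l^1 -> l^2]: the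
    arithmetic-geometric mean inequality is applied to the two square-summable
    factors, and each of the resulting sums decouples. *)
Lemma tri_young M al be ga :
  (forall k, 0 <= al k) -> (forall k, 0 <= be k) -> (forall k, 0 <= ga k) ->
  tri M (fun p q r => al p * be q * ga r) <=
  (\sum_(q <- zs M) be q) *
  ((\sum_(p <- zs M) al p ^+ 2 + \sum_(r <- zs M) ga r ^+ 2) / 2).
Proof.
move=> al0 be0 ga0.
have : tri M (fun p q r => al p * be q * ga r) <=
    tri M (fun p q r => be q * (al p ^+ 2 / 2) + be q * (ga r ^+ 2 / 2)).
  apply: ler_tri => p q r _; rewrite -mulrDr -subr_ge0.
  rewrite (_ : _ - _ = be q * ((al p - ga r) ^+ 2 / 2)); last by field.
  by rewrite mulr_ge0// divr_ge0// sqr_ge0.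
move=> /le_trans; apply; rewrite triD mulrDl mulrDr.
apply: lerD; rewrite [X in _ * X]mulr_suml.
  by apply: tri_mid_le => // k; rewrite divr_ge0 ?sqr_ge0.
rewrite tri_swap23 tri_swap12 tri_swap23.
by apply: tri_mid_le => // k; rewrite divr_ge0 ?sqr_ge0.
Qed.

End Young.

(** * Convolution estimates *)

Definition conv (A : pzRingType) M (b c : int -> A) (k : int) : A :=
  \sum_(p <- zs M) \sum_(q <- zs M) (b p * c q) *+ (p + q == k).


Section Convolution.
Variable R : realType.
Local Notation nm := (@Normc.normc R).
Implicit Types (a b c th : int -> R[i]).

Lemma nm_ge0 (z : R[i]) : 0 <= nm z.
Proof. by case: z => x y; exact: sqrtr_ge0. Qed.

Lemma nm_sum I (s : seq I) (F : I -> R[i]) :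
  nm (\sum_(i <- s) F i) <= \sum_(i <- s) nm (F i).
Proof.
elim/big_ind2: _ => [|x y z w xy zw|//]; first by rewrite Normc.normc0.
by apply: le_trans (lerD xy zw); exact: le_normcD.
Qed.

Lemma nm_mulrn (z : R[i]) n : nm (z *+ n) = nm z *+ n.
Proof. exact: normcMn. Qed.

Lemma sqr_nm (z : R[i]) : nm z ^+ 2 = complex.Re z ^+ 2 + complex.Im z ^+ 2.
Proof. by case: z => x y /=; rewrite sqr_sqrtr// addr_ge0 ?sqr_ge0. Qed.

Lemma sqr_nmD (z w : R[i]) : nm (z + w) ^+ 2 <= 2 * nm z ^+ 2 + 2 * nm w ^+ 2.
Proof.
apply: (@le_trans _ _ ((nm z + nm w) ^+ 2)).
  by rewrite lerXn2r ?nnegrE ?addr_ge0 ?nm_ge0 ?le_normcD.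
rewrite -subr_ge0 (_ : _ - _ = (nm z - nm w) ^+ 2) ?sqr_ge0//.
by ring.
Qed.

Lemma nm_real (x : R) : nm x%:C = `|x|.
Proof. by rewrite /= expr0n addr0 sqrtr_sqr. Qed.

Lemma nm_imag (x : R) : nm (0 +i* x) = `|x|.
Proof. by rewrite /= expr0n add0r sqrtr_sqr. Qed.

Lemma real_complex_int (k : int) : k%:~R = (k%:~R : R)%:C.
Proof. by rewrite (rmorph_int (real_complex R)). Qed.

Lemma nm_int (k : int) : nm k%:~R = `|k%:~R|.
Proof. by rewrite real_complex_int nm_real. Qed.

Lemma nm_tri M (F : int -> int -> int -> R[i]) :
  nm (tri M F) <= tri M (fun p q r => nm (F p q r)).
Proof.
apply: le_trans (nm_sum _ _) _; apply: ler_sum => p _.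
apply: le_trans (nm_sum _ _) _; apply: ler_sum => q _.
apply: le_trans (nm_sum _ _) _; apply: ler_sum => r _.
by rewrite nm_mulrn.
Qed.

Lemma conv_cut N M b c k : (N <= M)%N ->
  conv N b c k = conv M (cut N b) (cut N c) k.
Proof.
move=> NM; rewrite /conv -(sum_cut _ NM); apply: eq_bigr => p _.
rewrite /cut; case: ifP => pN; last first.
  by rewrite big1 // => q _; rewrite mul0r mul0rn.
rewrite -(sum_cut _ NM); apply: eq_bigr => q _; rewrite /cut.
by case: ifP => // _; rewrite mulr0 mul0rn.
Qed.

(** Testing against [th] amounts to pairing the frequency [k] with [r = - k],
    which makes the roles of the three frequencies symmetric. *)
Lemma conv_tri M b c th :
  \sum_(k <- zs M) k%:~R * conv M b c k * th (- k) =
  - tri M (fun p q r => r%:~R * (b p * c q * th r)).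
Proof.
rewrite -sum_zsN (eq_bigr (fun r => \sum_(p <- zs M) \sum_(q <- zs M)
    - ((r%:~R * (b p * c q * th r)) *+ (p + q + r == 0)))); last first.
  move=> r _; rewrite opprK /conv mulr_sumr mulr_suml.
  apply: eq_bigr => p _; rewrite mulr_sumr mulr_suml.
  apply: eq_bigr => q _; rewrite -subr_eq0 opprK mulrnAr mulrnAl.
  by case: eqP => // _; rewrite ?mulr0n ?oppr0// !mulr1n rmorphN; ring.
rewrite exchange_big /tri -sumrN; apply: eq_bigr => p _.
rewrite exchange_big -sumrN; apply: eq_bigr => q _.
by rewrite -sumrN.
Qed.

(** The three frequencies of a cubic term play the same role, and add up to
    zero. *)
Lemma tri_cubic0 M th : tri M (fun p q r => r%:~R * (th p * th q * th r)) = 0.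
Proof.
set S := tri _ _.
have S1 : S = tri M (fun p q r => q%:~R * (th p * th q * th r)).
  by rewrite /S tri_swap23; apply: eq_tri => p q r _; ring.
have S2 : S = tri M (fun p q r => p%:~R * (th p * th q * th r)).
  by rewrite S1 tri_swap12; apply: eq_tri => p q r _; ring.
have : S *+ 3 = 0.
  rewrite !mulrS mulr0n addr0 {1}S2 {1}S1 -!triD.
  rewrite (eq_tri (G := fun _ _ _ => 0 * 0)); first by rewrite triZ mul0r.
  by move=> p q r pqr; rewrite (_ : r = - (p + q)) ?rmorphN ?rmorphD/=; [ring|lia].
by move/eqP; rewrite mulrn_eq0 => /eqP.
Qed.

(** Integration by parts: [2 th th_x] is the derivative of [th^2], and the
    derivative is moved to [w]. *)
Lemma tri_by_parts M w th :
  tri M (fun p q r => r%:~R * (w p * th q * th r)) *+ 2 =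
  - tri M (fun p q r => p%:~R * w p * th q * th r).
Proof.
rewrite mulr2n {1}tri_swap23 -triD -mulN1r -triZ; apply: eq_tri => p q r pqr.
by rewrite (_ : r = - (p + q)) ?rmorphN ?rmorphD/=; [ring|lia].
Qed.

(** With [a = w + th], [c = w + rho] and
    [w = P_N c], the difference of the quadratic terms is
    [2 w th + th th - rho (w + c)]. The first summand is integrated by parts,
    the second contributes nothing, and the third involves only the high
    frequencies of [c]. *)
Lemma nonlinear_error N M a c (K dl : R) : (N <= M)%N ->
  \sum_(k <- zs M) (1 + `|k%:~R|) * nm (c k) <= K ->
  \sum_(k <- zs M) (1 + k%:~R ^+ 2) * nm (c k - cut N c k) ^+ 2 <= dl ->
  let th := cut N (fun k => a k - c k) in
  nm (\sum_(k <- zs N) k%:~R * (conv N a a k - conv M c c k) * th (- k)) <=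
  3 * K * (\sum_(k <- zs N) nm (th k) ^+ 2) + K * dl.
Proof.
move=> NM cK rhod; cbv zeta; set th := cut N _.
pose w := cut N c; pose rho k := c k - w k; pose g k := w k + c k.
have -> : \sum_(k <- zs N) k%:~R * (conv N a a k - conv M c c k) * th (- k) =
   tri M (fun p q r => p%:~R * w p * th q * th r) -
   tri M (fun p q r => p%:~R * rho p * g q * th r) -
   tri M (fun p q r => rho p * (q%:~R * g q) * th r).
  have -> : \sum_(k <- zs N) k%:~R * (conv N a a k - conv M c c k) * th (- k) =
    \sum_(k <- zs M) k%:~R * conv M (cut N a) (cut N a) k * th (- k) -
    \sum_(k <- zs M) k%:~R * conv M c c k * th (- k).
    rewrite -sumrB -(sum_cut _ NM); apply: eq_bigr => k _; rewrite /cut.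
    case: ifP => kN; first by rewrite (conv_cut _ _ _ NM); ring.
    by rewrite /th /cut abszN kN !mulr0 subr0.
  rewrite !conv_tri opprK addrC -mulN1r -triZ -triD.
  transitivity (
    - (tri M (fun p q r => r%:~R * (w p * th q * th r)) +
       tri M (fun p q r => r%:~R * (w q * th p * th r))) -
    tri M (fun p q r => r%:~R * (th p * th q * th r)) +
    (tri M (fun p q r => r%:~R * (rho p * w q * th r)) +
     tri M (fun p q r => r%:~R * (rho q * c p * th r)))).
    rewrite -!triD -[X in _ = - X - _ + _]mul1r -mulNr -triZ.
    rewrite -[X in _ = _ - X + _]mul1r -mulNr -triZ -!triD.
    apply: eq_tri => p q r _.
    have E k : cut N a k = w k + th k.
      by rewrite /w /th /cut; case: ifP => _; ring.
    have F k : c k = w k + rho k by rewrite /rho; ring.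
    by rewrite !E (F p) (F q); ring.
  rewrite tri_cubic0 subr0.
  rewrite [X in - (_ + X)]tri_swap12 -mulr2n tri_by_parts opprK.
  rewrite [X in _ + (_ + X) = _]tri_swap12 -triD.
  rewrite addrCA; congr (_ + _).
  rewrite addrC -opprD -triD -mulN1r -triZ; apply: eq_tri => p q r pqr.
  by rewrite (_ : r = - (p + q)) ?rmorphN ?rmorphD /g/=; [ring|lia].
have w_le k : nm (w k) <= nm (c k).
  by rewrite /w /cut; case: ifP => // _; rewrite Normc.normc0 nm_ge0.
have g_le k : nm (g k) <= 2 * nm (c k).
  by rewrite mulr_natl mulr2n; apply: le_trans (le_normcD _ _) _; rewrite lerD2r.
set Th := \sum_(k <- zs N) _.
have ThE : \sum_(k <- zs M) nm (th k) ^+ 2 = Th.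
  rewrite /Th -(sum_cut _ NM); apply: eq_bigr => k _; rewrite /cut.
  by case: ifP => // kN; rewrite /th /cut kN Normc.normc0 expr0n.
have nn k : 0 <= nm (c k) by exact: nm_ge0.
have Th0 : 0 <= Th by apply: sumr_ge0 => k _; exact: sqr_ge0.
have split : \sum_(k <- zs M) nm (c k) + \sum_(k <- zs M) `|k%:~R| * nm (c k) <= K.
  by rewrite -big_split /=; under eq_bigr do rewrite -[X in X + _]mul1r -mulrDl.
have s0 : 0 <= \sum_(k <- zs M) nm (c k) by apply: sumr_ge0.
have s1 : 0 <= \sum_(k <- zs M) `|k%:~R| * nm (c k).
  by apply: sumr_ge0 => k _; rewrite mulr_ge0.
have t1 : nm (tri M (fun p q r => p%:~R * w p * th q * th r)) <=
    (\sum_(k <- zs M) `|k%:~R| * nm (c k)) * Th.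
  apply: le_trans (nm_tri _ _) _.
  rewrite tri_swap12; apply: le_trans (ler_tri (G := fun p q r =>
     nm (th p) * (`|q%:~R| * nm (c q)) * nm (th r)) _) _.
    move=> p q r _; rewrite !Normc.normcM nm_int.
    rewrite [nm (th p) * _]mulrC ler_wpM2r ?nm_ge0// ler_wpM2r ?nm_ge0//.
    by rewrite ler_wpM2l.
  apply: le_trans (tri_young _ _ _ _) _ => [k|k|k|]; rewrite ?mulr_ge0 ?nm_ge0//.
  by rewrite ThE; rewrite (_ : (Th + Th) / 2 = Th); last by field.
have rd : \sum_(k <- zs M) nm (rho k) ^+ 2 +
    \sum_(k <- zs M) (`|k%:~R| * nm (rho k)) ^+ 2 <= dl.
  apply: le_trans rhod; rewrite -big_split; apply: ler_sum => k _ /=.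
  by rewrite exprMn real_normK ?num_real// mulrDl mul1r.
have r0 : 0 <= \sum_(k <- zs M) nm (rho k) ^+ 2.
  by apply: sumr_ge0 => k _; exact: sqr_ge0.
have r1 : 0 <= \sum_(k <- zs M) (`|k%:~R| * nm (rho k)) ^+ 2.
  by apply: sumr_ge0 => k _; exact: sqr_ge0.
have t2 : nm (tri M (fun p q r => p%:~R * rho p * g q * th r)) <=
    (\sum_(k <- zs M) nm (c k)) *
    (\sum_(k <- zs M) (`|k%:~R| * nm (rho k)) ^+ 2 + Th).
  apply: le_trans (nm_tri _ _) _.
  apply: le_trans (ler_tri (G := fun p q r =>
     (`|p%:~R| * nm (rho p)) * (2 * nm (c q)) * nm (th r)) _) _.
    move=> p q r _; rewrite !Normc.normcM nm_int.
    by rewrite ler_wpM2r ?nm_ge0// ler_wpM2l ?mulr_ge0 ?nm_ge0.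
  apply: le_trans (tri_young _ _ _ _) _ => [k|k|k|]; rewrite ?mulr_ge0 ?nm_ge0//.
  by rewrite ThE -mulr_sumr le_eqVlt; apply/orP; left; apply/eqP; field.
have t3 : nm (tri M (fun p q r => rho p * (q%:~R * g q) * th r)) <=
    (\sum_(k <- zs M) `|k%:~R| * nm (c k)) *
    (\sum_(k <- zs M) nm (rho k) ^+ 2 + Th).
  apply: le_trans (nm_tri _ _) _.
  apply: le_trans (ler_tri (G := fun p q r =>
     nm (rho p) * (2 * (`|q%:~R| * nm (c q))) * nm (th r)) _) _.
    move=> p q r _; rewrite !Normc.normcM nm_int.
    rewrite ler_wpM2r ?nm_ge0// ler_wpM2l ?nm_ge0//.
    by rewrite mulrCA ler_wpM2l.
  apply: le_trans (tri_young _ _ _ _) _ => [k|k|k|]; rewrite ?mulr_ge0 ?nm_ge0//.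
  by rewrite ThE -mulr_sumr le_eqVlt; apply/orP; left; apply/eqP; field.
apply: le_trans (le_normcD _ _) _; rewrite normcN.
apply: le_trans (lerD (le_normcD _ _) (lexx _)) _; rewrite normcN.
apply: le_trans (lerD (lerD t1 t2) t3) _.
move: split s0 s1 r0 r1 rd Th0.
set x := \sum_(k <- zs M) nm (c k).
set y := \sum_(k <- zs M) `|k%:~R| * nm (c k).
set u := \sum_(k <- zs M) nm (rho k) ^+ 2.
set v := \sum_(k <- zs M) (_ * _) ^+ 2.
clear -x y u v => sp x0 y0 u0 v0 uv T0; nra.
Qed.

End Convolution.

Lemma sum_zsS (V : nmodType) M (F : int -> V) :
  \sum_(k <- zs M.+1) F k = \sum_(k <- zs M) F k + (F M.+1%:Z + F (- M.+1%:Z)).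
Proof.
rewrite (perm_big (M.+1%:Z :: - M.+1%:Z :: zs M)).
  by rewrite !big_cons /= addrA addrC.
apply: uniq_perm; rewrite /= ?uniq_zs ?inE ?mem_zs ?andbT//.
  by lia.
by move=> k; rewrite !inE !mem_zs; lia.
Qed.

Lemma sum_zs0 (V : nmodType) (F : int -> V) : \sum_(k <- zs 0) F k = F 0.
Proof.
rewrite (perm_big [:: 0]) ?big_seq1//; apply: uniq_perm => //; first exact: uniq_zs.
by move=> k; rewrite !inE !mem_zs; lia.
Qed.

Lemma convC (A : comPzRingType) M (b c : int -> A) k : conv M b c k = conv M c b k.
Proof.
rewrite /conv exchange_big; apply: eq_bigr => p _; apply: eq_bigr => q _.
by rewrite mulrC addrC.
Qed.

Section Sobolev.
Variable R : realType.
Local Notation nm := (@Normc.normc R).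
Implicit Types (b c : int -> R[i]).

(** The square of the [H^s] norm, restricted to frequencies at most [M]. *)
Definition sob s M c : R :=
  \sum_(k <- zs M) (1 + k%:~R ^+ 2) ^+ s * nm (c k) ^+ 2.

Lemma sqrp1_gt0 (k : int) : 0 < 1 + k%:~R ^+ 2 :> R.
Proof. by rewrite ltr_pwDl// sqr_ge0. Qed.

Lemma sqrp1_ge1 (k : int) : 1 <= 1 + k%:~R ^+ 2 :> R.
Proof. by rewrite lerDl sqr_ge0. Qed.

Lemma sob_term_ge0 s c (k : int) : 0 <= (1 + k%:~R ^+ 2) ^+ s * nm (c k) ^+ 2.
Proof. by rewrite mulr_ge0 ?exprn_ge0 ?nm_ge0// ltW ?sqrp1_gt0. Qed.

Lemma sob_ge0 s M c : 0 <= sob s M c.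
Proof. by apply: sumr_ge0 => k _; exact: sob_term_ge0. Qed.

Lemma sum_inv_sqrp1 M : \sum_(k <- zs M) (1 + k%:~R ^+ 2)^-1 <= 8 :> R.
Proof.
(* The bound [8 - 4 / (M + 1)] is inductive since
   [2 / (1 + x^2) <= 4 / x - 4 / (x + 1)] for [x >= 1]. *)
suff : \sum_(k <- zs M) (1 + k%:~R ^+ 2)^-1 <= 8 - 4 / M.+1%:R :> R.
  by move/le_trans; apply; rewrite gerBl divr_ge0.
elim: M => [|M IH]; first by rewrite sum_zs0 expr0n addr0 invr1; lra.
rewrite sum_zsS; apply: le_trans (lerD IH (lexx _)) _.
rewrite rmorphN sqrrN /=.
have -> : (M.+1%:Z)%:~R = M.+1%:R :> R by [].
rewrite -[M.+2]addn1 natrD.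
have : 1 <= M.+1%:R :> R by rewrite ler1n.
move: (M.+1%:R : R) => x x1'; have x0 : 0 < x by exact: lt_le_trans x1'.
rewrite -subr_ge0.
have x1 : 1 + x ^+ 2 != 0 by rewrite gt_eqF// ltr_pwDl// sqr_ge0.
have x2 : x + 1 != 0 by rewrite gt_eqF// ltr_wpDl// ltW.
have x3 : x != 0 by rewrite gt_eqF.
rewrite (_ : _ - _ = (2 * x ^+ 2 - 2 * x + 4) / (x * (x + 1) * (1 + x ^+ 2))).
  apply: divr_ge0; first by nra.
  by rewrite !mulr_ge0 ?addr_ge0 ?sqr_ge0 ?(ltW x0).
by field; rewrite x1 x2 x3.
Qed.

Lemma sob_le s s' M c : (s <= s')%N -> sob s M c <= sob s' M c.
Proof.
move=> ss; apply: ler_sum => k _; rewrite ler_wpM2r ?sqr_ge0//.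
by rewrite ler_weXn2l// sqrp1_ge1.
Qed.

Lemma sobD s M b c : sob s M (fun k => b k + c k) <= 2 * sob s M b + 2 * sob s M c.
Proof.
rewrite /sob !mulr_sumr -big_split; apply: ler_sum => k _ /=.
have := exprn_ge0 s (ltW (sqrp1_gt0 k)); move: ((1 + _) ^+ s) => w w0.
rewrite (_ : _ + _ = w * (2 * nm (b k) ^+ 2 + 2 * nm (c k) ^+ 2)); last by ring.
by rewrite ler_wpM2l// sqr_nmD.
Qed.

(** The embedding of [H^1] into absolutely convergent Fourier series, by the
    arithmetic-geometric mean inequality. *)
Lemma sum_nm_le M c : \sum_(k <- zs M) nm (c k) <= (sob 1 M c + 8) / 2.
Proof.
rewrite ler_pdivlMr// mulr_suml; apply: le_trans (lerD (lexx _) (sum_inv_sqrp1 M)).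
rewrite -big_split; apply: ler_sum => k _ /=; rewrite expr1.
have := sqrp1_gt0 k; set w := 1 + _ => w0; rewrite -subr_ge0.
rewrite (_ : _ - _ = (w * nm (c k) - 1) ^+ 2 / w).
  by rewrite divr_ge0 ?sqr_ge0// ltW.
by field; rewrite gt_eqF.
Qed.

Lemma one_abs_sqr_le (k : int) : (1 + `|k%:~R|) ^+ 2 <= 2 * (1 + k%:~R ^+ 2) :> R.
Proof.
by rewrite -[k%:~R ^+ 2]real_normK ?num_real//; rewrite -subr_ge0
  (_ : _ - _ = (1 - `|k%:~R|) ^+ 2) ?sqr_ge0//; ring.
Qed.

(** One order higher than [sum_nm_le], for the derivative. *)
Lemma sum_dnm_le M c :
  \sum_(k <- zs M) (1 + `|k%:~R|) * nm (c k) <= sob 2 M c + 4.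
Proof.
rewrite (_ : 4 = 8 / 2); last by field.
have h : (\sum_(k <- zs M) (1 + k%:~R ^+ 2)^-1) / 2 <= 8 / 2 :> R.
  by rewrite ler_pM2r ?invr_gt0// sum_inv_sqrp1.
apply: le_trans (lerD (lexx _) h).
rewrite mulr_suml -big_split; apply: ler_sum => k _ /=.
have := one_abs_sqr_le k; have := sqrp1_gt0 k; set w := 1 + k%:~R ^+ 2 => w0.
set x := 1 + _; move: (nm _) => n xw; rewrite -subr_ge0.
rewrite (_ : _ - _ = ((2 * w - x ^+ 2) * n ^+ 2 * w + (x * n * w - 1) ^+ 2 / w) / 2).
  apply: divr_ge0 => //; apply: addr_ge0; last by rewrite divr_ge0 ?sqr_ge0 ?ltW.
  by apply: mulr_ge0 (ltW w0); apply: mulr_ge0 (sqr_ge0 _); rewrite subr_ge0.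
by field; rewrite gt_eqF.
Qed.

(** [l^1 * l^2 -> l^2], by testing [tri_young] against the convolution. *)
Lemma conv_young M (be al : int -> R) :
  (forall k, 0 <= be k) -> (forall k, 0 <= al k) ->
  \sum_(k <- zs M) conv M be al k ^+ 2 <=
  (\sum_(k <- zs M) be k) ^+ 2 * \sum_(k <- zs M) al k ^+ 2.
Proof.
move=> be0 al0; set B := \sum_(k <- zs M) be k; set A := \sum_(k <- zs M) al k ^+ 2.
pose z k := conv M be al (- k).
have z0 k : 0 <= z k.
  apply: sumr_ge0 => p _; apply: sumr_ge0 => q _.
  by rewrite mulrn_wge0// mulr_ge0.
have B0 : 0 <= B by apply: sumr_ge0.
rewrite -sum_zsN -/(z _).
under eq_bigr do rewrite -/(z _).
set Z := \sum_(k <- zs M) z k ^+ 2.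
have ZE : tri M (fun p q r => al p * be q * z r) = Z.
  rewrite tri_swap12 /tri /Z.
  under [RHS]eq_bigr => r _.
    rewrite expr2 {1}/z /conv mulr_suml.
    under eq_bigr => p _.
      rewrite mulr_suml.
      under eq_bigr => q _ do rewrite mulrnAl.
      over.
    over.
  rewrite [RHS]exchange_big; apply: eq_bigr => p _.
  rewrite [RHS]exchange_big; apply: eq_bigr => q _; apply: eq_bigr => r _.
  by rewrite [al q * _]mulrC -[_ == - r]subr_eq0 opprK.
have [B_eq0|Bneq0] := eqVneq B 0.
  have := tri_young M al0 be0 z0.
  by rewrite ZE -/B B_eq0 mul0r => /le_trans; apply; rewrite expr0n mul0r.
(* Scaling [al] by [B] balances the two terms of [tri_young], and the sum of
   squares of the convolution on the right is absorbed on the left. *)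
have Bal k : 0 <= B * al k by exact: mulr_ge0.
have := tri_young M Bal be0 z0.
rewrite (eq_tri (G := fun p q r => B * (al p * be q * z r))); last first.
  by move=> p q r _; ring.
rewrite triZ ZE -/B -/Z ler_pM2l ?lt_neqAle 1?eq_sym ?Bneq0//.
under eq_bigr do rewrite exprMn.
by rewrite -mulr_sumr -/A; move: (B ^+ 2 * A) => x; lra.
Qed.

Lemma nm_conv_le M b c k : nm (conv M b c k) <=
  conv M (fun p => nm (b p)) (fun q => nm (c q)) k.
Proof.
apply: le_trans (nm_sum _ _) _; apply: ler_sum => p _.
apply: le_trans (nm_sum _ _) _; apply: ler_sum => q _.
by rewrite nm_mulrn Normc.normcM.
Qed.

(** [H^s] is an algebra: [(1 + |p + q|)^s <= 2^s ((1 + |p|)^s + (1 + |q|)^s)]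
    puts the weight on one of the two factors, and the other one is summable. *)
Lemma sob_conv s M b c : sob s M (conv M b c) <=
  2 * 8 ^+ s * ((\sum_(k <- zs M) nm (c k)) ^+ 2 * sob s M b +
                (\sum_(k <- zs M) nm (b k)) ^+ 2 * sob s M c).
Proof.
pose v (k : int) : R := (1 + `|k%:~R|) ^+ s.
have v0 k : 0 <= v k by rewrite exprn_ge0// addr_ge0.
pose vb k := v k * nm (b k); pose vc k := v k * nm (c k).
pose nb k := nm (b k); pose nc k := nm (c k).
have vb0 k : 0 <= vb k by rewrite mulr_ge0 ?nm_ge0.
have vc0 k : 0 <= vc k by rewrite mulr_ge0 ?nm_ge0.
have nb0 k : 0 <= nb k by exact: nm_ge0.
have nc0 k : 0 <= nc k by exact: nm_ge0.
have vbE : \sum_(k <- zs M) vb k ^+ 2 <= 2 ^+ s * sob s M b.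
  rewrite mulr_sumr; apply: ler_sum => k _; rewrite mulrA /vb exprMn ler_wpM2r ?sqr_ge0//.
  rewrite -exprM mulnC exprM -exprMn lerXn2r ?nnegrE ?sqr_ge0 ?mulr_ge0//.
    by rewrite ltW ?sqrp1_gt0.
  exact: one_abs_sqr_le.
have vcE : \sum_(k <- zs M) vc k ^+ 2 <= 2 ^+ s * sob s M c.
  rewrite mulr_sumr; apply: ler_sum => k _; rewrite mulrA /vc exprMn ler_wpM2r ?sqr_ge0//.
  rewrite -exprM mulnC exprM -exprMn lerXn2r ?nnegrE ?sqr_ge0 ?mulr_ge0//.
    by rewrite ltW ?sqrp1_gt0.
  exact: one_abs_sqr_le.
have vD p q : v (p + q) <= 2 ^+ s * (v p + v q).
  have h x y : 0 <= x -> x <= y -> (1 + `|(p + q)%:~R|) <= 2 * (1 + y) ->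
    v (p + q) <= 2 ^+ s * (1 + y) ^+ s.
    move=> x0 xy pq; rewrite -exprMn lerXn2r ?nnegrE ?addr_ge0//.
    by rewrite mulr_ge0 ?addr_ge0// (le_trans x0).
  have tri1 : `|(p + q)%:~R| <= `|p%:~R| + `|q%:~R| :> R.
    by rewrite rmorphD; exact: ler_normD.
  have [pq|/ltW qp] := leP (`|p%:~R| : R) `|q%:~R|.
    apply: le_trans (h _ _ (normr_ge0 (p%:~R : R)) pq _) _; first by lra.
    by rewrite ler_wpM2l ?exprn_ge0// lerDr.
  apply: le_trans (h _ _ (normr_ge0 (q%:~R : R)) qp _) _; first by lra.
  by rewrite ler_wpM2l ?exprn_ge0// lerDl.
have key k : v k * nm (conv M b c k) <= 2 ^+ s * (conv M vb nc k + conv M nb vc k).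
  apply: le_trans (ler_wpM2l (v0 k) (nm_conv_le _ _ _ _)) _.
  rewrite /conv -big_split /= !mulr_sumr; apply: ler_sum => p _.
  rewrite -big_split /= !mulr_sumr; apply: ler_sum => q _.
  rewrite -mulrnDl !mulrnAr; case: eqP => // <-; rewrite !mulr1n.
  rewrite (_ : vb p * nc q + _ = (v p + v q) * (nb p * nc q)); last first.
    by rewrite /vb /vc /nb /nc; ring.
  by rewrite [leRHS]mulrA ler_wpM2r// mulr_ge0 ?nm_ge0.
have : sob s M (conv M b c) <= 2 * 4 ^+ s *
    (\sum_(k <- zs M) conv M nc vb k ^+ 2 + \sum_(k <- zs M) conv M nb vc k ^+ 2).
  rewrite -big_split mulr_sumr; apply: ler_sum => k _ /=.
  have h1 : (1 + k%:~R ^+ 2) ^+ s * nm (conv M b c k) ^+ 2 <=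
      (v k * nm (conv M b c k)) ^+ 2.
    rewrite exprMn ler_wpM2r ?sqr_ge0// /v -exprM mulnC exprM.
    rewrite lerXn2r ?nnegrE ?sqr_ge0 ?(ltW (sqrp1_gt0 _))//.
    rewrite -[k%:~R ^+ 2]real_normK ?num_real// -subr_ge0.
    by rewrite (_ : _ - _ = 2 * `|k%:~R|) ?mulr_ge0//; ring.
  apply: le_trans h1 _.
  have h2 : (v k * nm (conv M b c k)) ^+ 2 <=
      (2 ^+ s * (conv M nc vb k + conv M nb vc k)) ^+ 2.
    have kk := key k; rewrite (convC _ vb) in kk.
    have vn0 : 0 <= v k * nm (conv M b c k) by rewrite mulr_ge0 ?nm_ge0.
    by rewrite lerXn2r ?nnegrE// (le_trans vn0).
  apply: le_trans h2 _; rewrite exprMn -exprM mulnC exprM.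
  rewrite (_ : 2 ^+ 2 = 4 :> R); last by ring.
  rewrite [2 * _]mulrC -mulrA ler_wpM2l ?exprn_ge0//.
  by move: (conv _ _ _ _) (conv _ _ _ _) => x y; rewrite -subr_ge0
    (_ : _ - _ = (x - y) ^+ 2) ?sqr_ge0//; ring.
move=> /le_trans; apply.
rewrite (_ : 8 = 4 * 2); last by ring.
rewrite exprMn [2 * (_ * _)]mulrA -[leRHS]mulrA ler_wpM2l ?mulr_ge0 ?exprn_ge0//.
rewrite mulrDr; apply: lerD.
  apply: le_trans (conv_young _ nc0 vb0) _.
  by rewrite [leRHS]mulrCA ler_wpM2l ?sqr_ge0.
apply: le_trans (conv_young _ nb0 vc0) _.
by rewrite [leRHS]mulrCA ler_wpM2l ?sqr_ge0.
Qed.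

End Sobolev.

(** * Derivatives on a closed interval *)

Section TimeDerivative.
Variables (R : realType) (T : R).
Implicit Types (f g : R -> R) (t d : R).

(** The derivative along [tnear], one-sided at [0] and [T]. *)
Definition has_dt f t d := (s - t)^-1 * (f s - f t) @[s --> tnear T t] --> d.

Lemma tnear_filter t : Filter (tnear T t).
Proof. exact: within_filter. Qed.

Lemma tnear_proper t : 0 < T -> t \in `[0, T] -> ProperFilter (tnear T t).
Proof.
move=> T0; rewrite in_itv/= => /andP[t0 tT]; apply: Build_ProperFilter_ex.
move=> A; rewrite /tnear /within /= => -[e /= e0 h].
have [tT'|Tt] := ltP t T.
  exists (Num.min T (t + e / 2)); apply: h => /=.
  - rewrite /ball /= ltr_distlC; case: (leP T (t + e / 2)) => ?; apply/andP; split; lra.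
  - by rewrite gt_eqF// lt_min tT'/=; lra.
  - rewrite in_itv/= ge_min lexx andbT le_min (ltW T0)/=; lra.
exists (Num.max 0 (t - e / 2)); apply: h => /=.
- rewrite /ball /= ltr_distlC; case: (leP 0 (t - e / 2)) => ?; apply/andP; split; lra.
- by rewrite lt_eqF// gt_max; apply/andP; split; lra.
- by rewrite in_itv/= le_max lexx/= ge_max; apply/andP; split; lra.
Qed.

#[local] Existing Instance tnear_filter.

Lemma tnearP t (P : R -> Prop) : (forall s, s \in `[0, T] -> s != t -> P s) ->
  \forall s \near tnear T t, P s.
Proof. by move=> h; exists 1 => //= s _ st sT; exact: h. Qed.

Lemma tnear_eq_cvg t (f g : R -> R) (l : R) :
  (forall s, s \in `[0, T] -> s != t -> f s = g s) ->
  f s @[s --> tnear T t] --> l -> g s @[s --> tnear T t] --> l.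
Proof. by move=> fg; apply: cvg_trans; apply: near_eq_cvg; apply: tnearP. Qed.

Lemma tnear_cvg_id t : s @[s --> tnear T t] --> t.
Proof.
apply/cvgrPdist_lt => e e0; exists e => //= s; by rewrite /ball/= .
Qed.

Lemma has_dt_unique t f d1 d2 : 0 < T -> t \in `[0, T] ->
  has_dt f t d1 -> has_dt f t d2 -> d1 = d2.
Proof. by move=> T0 /(tnear_proper T0) tp h1 h2; apply: (cvg_unique _ h1 h2). Qed.

Lemma has_dt_eq f g t d : t \in `[0, T] -> (forall s, s \in `[0, T] -> f s = g s) ->
  has_dt f t d -> has_dt g t d.
Proof.
by move=> tT fg; apply: tnear_eq_cvg => s sT _; rewrite !fg.
Qed.

Lemma has_dt_eq' f g t d : f =1 g -> has_dt f t d -> has_dt g t d.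
Proof. by move=> /funext ->. Qed.

Lemma has_dt_cvg f t d : has_dt f t d -> f s @[s --> tnear T t] --> f t.
Proof.
move=> h.
have : (s - t) * ((s - t)^-1 * (f s - f t)) + f t @[s --> tnear T t] --> (t - t) * d + f t.
  apply: cvgD; last exact: cvg_cst.
  by apply: cvgM => //; apply: cvgB; [exact: tnear_cvg_id|exact: cvg_cst].
rewrite subrr mul0r add0r; apply: cvg_trans; apply: near_eq_cvg.
apply: tnearP => s _ st /=.
by rewrite mulrA divff ?subr_eq0// mul1r subrK.
Qed.

Lemma has_dt_cst (x : R) t : has_dt (fun=> x) t 0.
Proof.
rewrite /has_dt; under eq_fun do rewrite subrr mulr0; exact: cvg_cst.
Qed.

Lemma has_dt_id t : has_dt id t 1.
Proof.
apply: tnear_eq_cvg (@cvg_cst _ (1 : R) _ _ (tnear_filter t)) => s _ st.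
by rewrite mulVf// subr_eq0.
Qed.

Lemma has_dtD f g t d e : has_dt f t d -> has_dt g t e ->
  has_dt (fun s => f s + g s) t (d + e).
Proof.
rewrite /has_dt => hf hg; apply: tnear_eq_cvg (cvgD hf hg) => s _ _ /=; ring.
Qed.

Lemma has_dtM f g t d e : has_dt f t d -> has_dt g t e ->
  has_dt (fun s => f s * g s) t (d * g t + f t * e).
Proof.
move=> hf hg; have gt := has_dt_cvg hg; rewrite /has_dt in hf hg.
have ft := @cvg_cst _ (f t) _ _ (tnear_filter t).
apply: tnear_eq_cvg (cvgD (cvgM hf gt) (cvgM ft hg)) => s _ _ /=; ring.
Qed.

Lemma has_dtZ (x : R) f t d : has_dt f t d -> has_dt (fun s => x * f s) t (x * d).
Proof.
by move=> hf; have := has_dtM (has_dt_cst x t) hf; rewrite mul0r add0r.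
Qed.

Lemma has_dtN f t d : has_dt f t d -> has_dt (fun s => - f s) t (- d).
Proof.
move=> hf; have := @has_dtZ (-1) _ _ _ hf; rewrite mulN1r.
by apply: has_dt_eq' => s; rewrite mulN1r.
Qed.

Lemma has_dtB f g t d e : has_dt f t d -> has_dt g t e ->
  has_dt (fun s => f s - g s) t (d - e).
Proof. by move=> hf /has_dtN; exact: has_dtD. Qed.

Lemma has_dt_sum I (s : seq I) (f : I -> R -> R) t (d : I -> R) :
  (forall i, has_dt (f i) t (d i)) ->
  has_dt (fun r => \sum_(i <- s) f i r) t (\sum_(i <- s) d i).
Proof.
move=> h; elim: s => [|i s IH].
  by rewrite big_nil; under eq_fun do rewrite big_nil; exact: has_dt_cst.
by rewrite big_cons; under eq_fun do rewrite big_cons; exact: has_dtD.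
Qed.

Lemma is_derive_has_dt f t d : is_derive t 1 f d -> has_dt f t d.
Proof.
move=> [df fd].
have : h^-1 *: (f (h *: 1 + t) - f t) @[h --> 0^'] --> d by rewrite -fd; exact: df.
move=> /cvgrPdist_lt h; apply/cvgrPdist_lt => e e0.
have [r /= r0 hr] := h e e0; exists r => //= s sr st _.
have := hr (s - t); rewrite /ball /= sub0r normrN.
rewrite [(s - t) *: 1]mulr1 subrK; apply; last by rewrite subr_eq0.
by rewrite distrC.
Qed.

Lemma has_dt_is_derive f t d : t \in `]0, T[ -> has_dt f t d -> is_derive t 1 f d.
Proof.
rewrite in_itv/= => /andP[t0 tT] h.
suff fd : h^-1 *: (f (h *: 1 + t) - f t) @[h --> 0^'] --> d.
  by apply: DeriveDef; [apply/cvg_ex; exists d|exact: cvg_lim fd].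
move/cvgrPdist_lt : h => h; apply/cvgrPdist_lt => e e0.
have [r /= r0 hr] := h e e0.
exists (Num.min r (Num.min t (T - t))); first by rewrite /= !lt_min r0 t0 subr_gt0.
move=> x /=; rewrite /ball /= sub0r normrN !lt_min => /and3P[xr xt xT] x0.
rewrite [x *: 1]mulr1; have := hr (x + t); rewrite addrK; apply.
- by rewrite /ball /= opprD addrCA subrr addr0 normrN.
- by rewrite -subr_eq0 addrK.
- by move: xt xT; rewrite !ltr_norml in_itv/= => /andP[? ?] /andP[? ?]; lra.
Qed.

Lemma has_dt_within_continuous f (d : R -> R) :
  (forall t, t \in `[0, T] -> has_dt f t (d t)) -> {within `[0, T], continuous f}.
Proof.
move=> h; apply/subspace_continuousP => t /= tT.
have /cvgrPdist_lt c := has_dt_cvg (h t tT).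
apply/cvgrPdist_lt => e e0; have [r /= r0 hr] := c e e0.
exists r => //= s sr sT; have [->|st] := eqVneq s t; first by rewrite subrr normr0.
exact: hr.
Qed.

(** Gronwall's inequality: [E exp (- K t) - D t] is nonincreasing. *)
Lemma gronwall (E E' : R -> R) (K D : R) : 0 <= K -> 0 <= D -> E 0 = 0 ->
  (forall t, t \in `[0, T] -> has_dt E t (E' t)) ->
  (forall t, t \in `[0, T] -> E' t <= K * E t + D) ->
  forall t, t \in `[0, T] -> E t <= D * T * expR (K * T).
Proof.
move=> K0 D0 E0 dE leE t tT.
pose G s := E s * expR (- K * s) - D * s.
pose G' s := E' s * expR (- K * s) + E s * (- K * expR (- K * s)) - D.
have dG s : s \in `[0, T] -> has_dt G s (G' s).
  move=> sT; apply: has_dtB; last by have := @has_dtZ D _ _ _ (@has_dt_id s); rewrite mulr1.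
  apply: has_dtM; first exact: dE.
  apply: is_derive_has_dt.
  have dK : is_derive s 1 ( *%R (- K)) (- K).
    by rewrite -[X in is_derive _ _ _ X]mulr1; exact: is_deriveZ.
  by rewrite [X in is_derive _ _ _ X]mulrC; exact: (is_derive1_comp (f := expR)).
have G'0 s : s \in `[0, T] -> G' s <= 0.
  move=> sT; rewrite /G' (_ : _ - D = (E' s - K * E s) * expR (- K * s) - D); last by ring.
  rewrite subr_le0; have := leE s sT; rewrite -lerBlDl => h.
  apply: (le_trans (ler_wpM2r (expR_ge0 _) h)).
  rewrite ler_piMr//; rewrite -expR0 ler_expR; move: sT; rewrite in_itv/= => /andP[s0 _].
  by rewrite mulNr oppr_le0 mulr_ge0.
have oc s : s \in `]0, T[ -> s \in `[0, T].
  by apply: subset_itv_oo_cc.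
have : G t <= G 0.
  move: (tT); rewrite in_itv/= => /andP[t0 tT'].
  apply: (@ler0_derive1_nincr _ G 0 T) => //.
  - by move=> s sT; have [] := has_dt_is_derive sT (dG _ (oc _ sT)).
  - move=> s sT; rewrite derive1E; have [_ ->] := has_dt_is_derive sT (dG _ (oc _ sT)).
    exact/G'0/oc.
  - exact: has_dt_within_continuous dG.
rewrite /G E0 mul0r mulr0 subr0 mulNr expRN subr_le0 ler_pdivrMr ?expR_gt0// => /le_trans; apply.
move: tT; rewrite in_itv/= => /andP[t0 tT].
apply: ler_pM; rewrite ?mulr_ge0 ?expR_ge0//; first exact: ler_wpM2l.
by rewrite ler_expR ler_wpM2l.
Qed.

End TimeDerivative.

Section ComplexTimeDerivative.
Variables (R : realType) (T : R).
Implicit Types (f g : R -> R[i]) (t : R) (d e : R[i]).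
Local Notation Re := complex.Re.
Local Notation Im := complex.Im.

Definition has_dtc f t d :=
  has_dt T (fun s => Re (f s)) t (Re d) /\ has_dt T (fun s => Im (f s)) t (Im d).

Lemma Re_add (z w : R[i]) : Re (z + w) = Re z + Re w. Proof. by case: z; case: w. Qed.
Lemma Im_add (z w : R[i]) : Im (z + w) = Im z + Im w. Proof. by case: z; case: w. Qed.
Lemma Re_mul (z w : R[i]) : Re (z * w) = Re z * Re w - Im z * Im w.
Proof. by case: z; case: w. Qed.
Lemma Im_mul (z w : R[i]) : Im (z * w) = Re z * Im w + Im z * Re w.
Proof. by case: z; case: w. Qed.
Lemma Re_opp (z : R[i]) : Re (- z) = - Re z. Proof. by case: z. Qed.
Lemma Im_opp (z : R[i]) : Im (- z) = - Im z. Proof. by case: z. Qed.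
Lemma Re_sum I (s : seq I) (F : I -> R[i]) :
  Re (\sum_(i <- s) F i) = \sum_(i <- s) Re (F i).
Proof. by elim/big_rec2: _ => // i x y _ <-; rewrite Re_add. Qed.
Lemma Im_sum I (s : seq I) (F : I -> R[i]) :
  Im (\sum_(i <- s) F i) = \sum_(i <- s) Im (F i).
Proof. by elim/big_rec2: _ => // i x y _ <-; rewrite Im_add. Qed.
Lemma complex_eq (z w : R[i]) : Re z = Re w -> Im z = Im w -> z = w.
Proof. by case: z => a b; case: w => c d /= -> ->. Qed.

Lemma has_dtc_eq f g t d : t \in `[0, T] -> (forall s, s \in `[0, T] -> f s = g s) ->
  has_dtc f t d -> has_dtc g t d.
Proof.
by move=> tT fg [h1 h2]; split; [move: h1|move: h2]; apply: has_dt_eq => // s sT; rewrite fg.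
Qed.

Lemma has_dtc_cst (z : R[i]) t : has_dtc (fun=> z) t 0.
Proof. by split; exact: has_dt_cst. Qed.

Lemma has_dtcD f g t d e : has_dtc f t d -> has_dtc g t e ->
  has_dtc (fun s => f s + g s) t (d + e).
Proof.
move=> [h1 h2] [h3 h4]; split.
  by rewrite Re_add; under eq_fun do rewrite Re_add; exact: has_dtD.
by rewrite Im_add; under eq_fun do rewrite Im_add; exact: has_dtD.
Qed.

Lemma has_dtcM f g t d e : has_dtc f t d -> has_dtc g t e ->
  has_dtc (fun s => f s * g s) t (d * g t + f t * e).
Proof.
move=> [h1 h2] [h3 h4]; split.
  under eq_fun do rewrite Re_mul.
  have := has_dtB (has_dtM h1 h3) (has_dtM h2 h4).
  by congr (has_dt _ _ _ _); rewrite Re_add !Re_mul; ring.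
under eq_fun do rewrite Im_mul.
have := has_dtD (has_dtM h1 h4) (has_dtM h2 h3).
by congr (has_dt _ _ _ _); rewrite Im_add !Im_mul; ring.
Qed.

Lemma has_dtcZ (z : R[i]) f t d : has_dtc f t d -> has_dtc (fun s => z * f s) t (z * d).
Proof.
by move=> hf; have := has_dtcM (has_dtc_cst z t) hf; rewrite mul0r add0r.
Qed.

Lemma has_dtcB f g t d e : has_dtc f t d -> has_dtc g t e ->
  has_dtc (fun s => f s - g s) t (d - e).
Proof.
move=> hf hg0; have hg := @has_dtcZ (-1) _ _ _ hg0; have := has_dtcD hf hg; rewrite mulN1r.
by under eq_fun do rewrite mulN1r.
Qed.

Lemma has_dtc_sum I (s : seq I) (f : I -> R -> R[i]) t (d : I -> R[i]) :
  (forall i, has_dtc (f i) t (d i)) ->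
  has_dtc (fun r => \sum_(i <- s) f i r) t (\sum_(i <- s) d i).
Proof.
move=> h; split.
  rewrite Re_sum; under eq_fun do rewrite Re_sum.
  by apply: has_dt_sum => i; have [] := h i.
rewrite Im_sum; under eq_fun do rewrite Im_sum.
by apply: has_dt_sum => i; have [] := h i.
Qed.

Lemma has_dtcMn f t d n : has_dtc f t d -> has_dtc (fun s => f s *+ n) t (d *+ n).
Proof.
move=> h; have := @has_dtcZ n%:R _ _ _ h; rewrite mulr_natl.
by under eq_fun do rewrite mulr_natl.
Qed.

End ComplexTimeDerivative.

(** * Trigonometric polynomials *)

Section Trigonometric.
Variable R : realType.
Local Notation nm := (@Normc.normc R).
Local Notation Re := complex.Re.
Local Notation Im := complex.Im.
Local Notation mu := (@lebesgue_measure R).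
Local Notation Ipi := (@Ipi R).
Local Notation intg f := (mu.-integrable Ipi (EFin \o f)).
Implicit Types (g h : R -> R[i]) (a b c : int -> R[i]) (k : int) (x : R).

Lemma expik0 x : expik 0 x = 1.
Proof. by rewrite /expik mul0r cos0 sin0. Qed.

Lemma expikD k l x : expik (k + l) x = expik k x * expik l x.
Proof.
rewrite /expik rmorphD mulrDl cosD sinD; by apply: complex_eq; rewrite ?Re_mul ?Im_mul /=; ring.
Qed.

Lemma expikN k x : expik (- k) x = conjc (expik k x).
Proof. by rewrite /expik rmorphN mulNr cosN sinN. Qed.

Lemma nm_expik k x : nm (expik k x) = 1.
Proof. by rewrite /= cos2Dsin2 sqrtr1. Qed.

Lemma measurable_Ipi : measurable (Ipi : set (measurableTypeR R)).
Proof. exact: measurable_itv. Qed.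

Lemma continuous_intg (f : R -> R) : continuous f -> intg f.
Proof.
move=> cf; apply: continuous_compact_integrable; first exact: segment_compact.
exact: continuous_subspaceT.
Qed.

Definition cintg g := intg (fun x => Re (g x)) /\ intg (fun x => Im (g x)).

Lemma intg_eq (f f' : R -> R) : f =1 f' -> intg f -> intg f'.
Proof. by move=> /funext ->. Qed.

Lemma intgD (f f' : R -> R) : intg f -> intg f' -> intg (fun x => f x + f' x).
Proof.
move=> h h'; have := integrableD measurable_Ipi h h'.
by apply: eq_integrable => //; exact: measurable_Ipi.
Qed.

Lemma intgZ (r : R) (f : R -> R) : intg f -> intg (fun x => r * f x).
Proof.
move=> h; have := integrableZl measurable_Ipi r h.
by apply: eq_integrable => //; exact: measurable_Ipi.
Qed.

Lemma cintegral_eq g h : (forall x, Ipi x -> g x = h x) -> cintegral g = cintegral h.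
Proof.
by move=> gh; rewrite /cintegral; congr (_ +i* _); apply: eq_Rintegral => x;
  rewrite inE => /gh ->.
Qed.

Lemma cintegralD g h : cintg g -> cintg h ->
  cintegral (fun x => g x + h x) = cintegral g + cintegral h.
Proof.
move=> [g1 g2] [h1 h2]; rewrite /cintegral; apply: complex_eq => /=.
  by under eq_Rintegral do rewrite Re_add; rewrite RintegralD//; exact: measurable_Ipi.
by under eq_Rintegral do rewrite Im_add; rewrite RintegralD//; exact: measurable_Ipi.
Qed.

Lemma cintgD g h : cintg g -> cintg h -> cintg (fun x => g x + h x).
Proof.
move=> [g1 g2] [h1 h2]; split.
  by apply: intg_eq (intgD g1 h1) => x; rewrite Re_add.
by apply: intg_eq (intgD g2 h2) => x; rewrite Im_add.
Qed.

Lemma cintgZ (z : R[i]) g : cintg g -> cintg (fun x => z * g x).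
Proof.
move=> [g1 g2]; split.
  apply: intg_eq (intgD (intgZ (Re z) g1) (intgZ (- Im z) g2)) => x.
  by rewrite Re_mul mulNr.
by apply: intg_eq (intgD (intgZ (Re z) g2) (intgZ (Im z) g1)) => x; rewrite Im_mul.
Qed.

Lemma cintegralZ (z : R[i]) g : cintg g ->
  cintegral (fun x => z * g x) = z * cintegral g.
Proof.
move=> [g1 g2]; rewrite /cintegral; apply: complex_eq; rewrite ?Re_mul ?Im_mul /=.
  under eq_Rintegral do rewrite Re_mul -mulNr.
  by rewrite RintegralD ?RintegralZl ?mulNr//; try exact: intgZ; exact: measurable_Ipi.
under eq_Rintegral do rewrite Im_mul.
by rewrite RintegralD ?RintegralZl//; try exact: intgZ; exact: measurable_Ipi.
Qed.

Lemma cintg0 : cintg (fun=> 0).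
Proof. by split; apply: continuous_intg => x; exact: cvg_cst. Qed.

Lemma cintegral0 : cintegral (fun=> 0 : R[i]) = 0.
Proof. by have := cintegralZ 0 cintg0; rewrite !mul0r. Qed.

Lemma cintg_sum I (s : seq I) (F : I -> R -> R[i]) :
  (forall i, cintg (F i)) -> cintg (fun x => \sum_(i <- s) F i x).
Proof.
move=> h; elim: s => [|i s IH].
  by under eq_fun do rewrite big_nil; exact: cintg0.
by under eq_fun do rewrite big_cons; exact: cintgD.
Qed.

Lemma cintegral_sum I (s : seq I) (F : I -> R -> R[i]) :
  (forall i, cintg (F i)) ->
  cintegral (fun x => \sum_(i <- s) F i x) = \sum_(i <- s) cintegral (F i).
Proof.
move=> h; elim: s => [|i s IH].
  by under eq_fun do rewrite big_nil; rewrite big_nil cintegral0.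
under eq_fun do rewrite big_cons.
by rewrite cintegralD ?big_cons ?IH//; exact: cintg_sum.
Qed.

Lemma continuous_cosk k : continuous (fun x : R => cos (k%:~R * x)).
Proof.
move=> x; apply: continuous_comp; last exact: continuous_cos.
exact: mulrl_continuous.
Qed.

Lemma continuous_sink k : continuous (fun x : R => sin (k%:~R * x)).
Proof.
move=> x; apply: continuous_comp; last exact: continuous_sin.
exact: mulrl_continuous.
Qed.

Lemma cintg_expik k : cintg (@expik R k).
Proof.
by split; apply: continuous_intg; [exact: continuous_cosk|exact: continuous_sink].
Qed.

Lemma is_derive_cosk k x :
  is_derive x 1 (fun y : R => cos (k%:~R * y)) (- (k%:~R * sin (k%:~R * x))).
Proof.
have dk : is_derive x 1 ( *%R (k%:~R : R)) k%:~R.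
  by rewrite -[X in is_derive _ _ _ X]mulr1; exact: is_deriveZ.
by rewrite -mulrN [X in is_derive _ _ _ X]mulrC; exact: (is_derive1_comp (f := cos)).
Qed.

Lemma is_derive_sink k x :
  is_derive x 1 (fun y : R => sin (k%:~R * y)) (k%:~R * cos (k%:~R * x)).
Proof.
have dk : is_derive x 1 ( *%R (k%:~R : R)) k%:~R.
  by rewrite -[X in is_derive _ _ _ X]mulr1; exact: is_deriveZ.
by rewrite [X in is_derive _ _ _ X]mulrC; exact: (is_derive1_comp (f := sin)).
Qed.

Lemma sin_kpi k : sin (k%:~R * pi) = 0 :> R.
Proof.
have h n : sin (n%:R * pi) = 0 :> R.
  elim: n => [|n IH]; first by rewrite mul0r sin0.
  by rewrite -[n.+1]addn1 natrD mulrDl mul1r sinDpi IH oppr0.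
case: k => n; first exact: h.
by rewrite NegzE rmorphN mulNr sinN (h n.+1) oppr0.
Qed.

Lemma Rintegral_derive (f F : R -> R) :
  (forall x, is_derive x 1 F (f x)) -> continuous f ->
  \int[mu]_(x in Ipi) f x = F pi - F (- pi).
Proof.
move=> dF cf; have ppi : - pi < pi :> R by have := pi_gt0 R; lra.
rewrite /Rintegral (continuous_FTC2 ppi (F := F))//.
- exact: continuous_subspaceT.
- have cF : continuous F.
    by move=> x; apply: differentiable_continuous; apply/derivable1_diffP; have [] := dF x.
  split=> [x _||]; first by have [] := dF x.
    exact/cvg_at_right_filter/cF.
  exact/cvg_at_left_filter/cF.
- by move=> x _; rewrite derive1E; have [_ ->] := dF x.
Qed.

Lemma cintegral_expik k : cintegral (@expik R k) = (pi *+ 2)%:C *+ (k == 0).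
Proof.
have [->|k0] := eqVneq k 0.
  rewrite /cintegral /=; under eq_Rintegral do rewrite mul0r cos0.
  under [in X in _ +i* X]eq_Rintegral do rewrite mul0r sin0.
  have -> : \int[mu]_(x in Ipi) 1 = pi - - pi :> R.
    apply: (@Rintegral_derive (fun=> 1) id) => x; exact: cvg_cst.
  have -> : \int[mu]_(x in Ipi) 0 = 0 - 0 :> R.
    apply: (@Rintegral_derive (fun=> 0) (fun=> 0)) => x; exact: cvg_cst.
  by rewrite opprK subr0 mulr2n.
have kR0 : k%:~R != 0 :> R by rewrite intr_eq0.
rewrite mulr0n /cintegral /=.
have -> : \int[mu]_(x in Ipi) cos (k%:~R * x) = 0 :> R.
  transitivity (k%:~R^-1 * sin (k%:~R * pi) - k%:~R^-1 * sin (k%:~R * - pi) : R).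
    apply: (@Rintegral_derive _ (fun x => k%:~R^-1 * sin (k%:~R * x))) => x.
      have := is_deriveZ (k%:~R^-1) (is_derive_sink k x).
      by rewrite /GRing.scale /= mulKf.
    exact: continuous_cosk.
  by rewrite mulrN sinN sin_kpi oppr0 mulr0 subrr.
have -> : \int[mu]_(x in Ipi) sin (k%:~R * x) = 0 :> R.
  transitivity (- k%:~R^-1 * cos (k%:~R * pi) - - k%:~R^-1 * cos (k%:~R * - pi) : R).
    apply: (@Rintegral_derive _ (fun x => - k%:~R^-1 * cos (k%:~R * x))) => x.
      have := is_deriveZ (- k%:~R^-1) (is_derive_cosk k x).
      by rewrite /GRing.scale /= mulrNN mulKf.
    exact: continuous_sink.
  by rewrite mulrN cosN subrr.
by [].
Qed.

Definition trig N a x : R[i] := \sum_(k <- zs N) a k * expik k x.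

Lemma cintg_trig N a : cintg (trig N a).
Proof. by apply: cintg_sum => k; apply/cintgZ/cintg_expik. Qed.

Lemma trig_mul_expik N a k x :
  expik k x * trig N a x = \sum_(l <- zs N) a l * expik (k + l) x.
Proof.
by rewrite mulr_sumr; apply: eq_bigr => l _; rewrite expikD mulrCA.
Qed.

Lemma pi2_neq0 : (pi *+ 2 : R) != 0.
Proof. by rewrite mulrn_eq0/= gt_eqF// pi_gt0. Qed.

Lemma pi2VK (z : R[i]) : ((pi *+ 2)^-1)%:C * ((pi *+ 2)%:C * z) = z.
Proof. by rewrite mulrA -rmorphM mulVf ?pi2_neq0// mul1r. Qed.

Lemma fourier_coef_trig N a k : fourier_coef (trig N a) k = cut N a k.
Proof.
rewrite /fourier_coef (cintegral_eq (h := fun x =>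
    \sum_(l <- zs N) a l * expik (- k + l) x)); last first.
  by move=> x _; rewrite trig_mul_expik.
rewrite cintegral_sum; last by move=> l; apply/cintgZ/cintg_expik.
rewrite -sum_pick mulr_sumr; apply: eq_bigr => l _.
rewrite cintegralZ; last exact: cintg_expik.
rewrite cintegral_expik [- k + l]addrC subr_eq0.
by case: eqP => _; rewrite ?mulr0n ?mulr0// !mulr1n [a l * _]mulrC pi2VK.
Qed.

Lemma trig_cut N a : trig N (cut N a) = trig N a.
Proof.
apply/funext => x; rewrite /trig big_seq [RHS]big_seq; apply: eq_bigr => k.
by rewrite mem_zs /cut => ->.
Qed.

Lemma SN_trig N g : SN N g -> g = trig N (fourier_coef g).
Proof.
have ZE k : (k \in zs N) -> exists i : 'I_(N.*2.+1), freq i = k.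
  by move=> /mapP[i _ ->]; exists i.
move=> [c gE].
pose a k := if pselect (exists i : 'I_(N.*2.+1), freq i = k) is left h
            then c (projT1 (cid h)) else 0.
have finj : injective (@freq N).
  by move=> i j; rewrite /freq => h; apply/val_inj; move: h => /=; lia.
have gT : g = trig N a.
  rewrite gE; apply/funext => x; rewrite /trig -sum_freq; apply: eq_bigr => i _.
  rewrite /a; case: pselect => [h|[]]; last by exists i.
  by case: (cid h) => j /= /finj ->.
rewrite {1}gT -trig_cut; congr (trig N _); apply/funext => k.
by rewrite gT fourier_coef_trig.
Qed.

Lemma SN_expik N k : (absz k <= N)%N -> SN N (@expik R k).
Proof.
rewrite -mem_zs => /mapP[i _ ->]; exists (fun j => (j == i)%:R).
apply/funext => x; rewrite (bigD1 i)//= eqxx mul1r big1 ?addr0// => j /negbTE ->.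
by rewrite mul0r.
Qed.

Lemma is_derive_sum_pt I (s : seq I) (f : I -> R -> R) (d : I -> R) x :
  (forall i, is_derive x 1 (f i) (d i)) ->
  is_derive x 1 (fun y => \sum_(i <- s) f i y) (\sum_(i <- s) d i).
Proof.
move=> h; elim: s => [|i s IH].
  by rewrite big_nil; under eq_fun do rewrite big_nil; exact: is_derive_cst.
by rewrite big_cons; under eq_fun do rewrite big_cons; exact: is_deriveD.
Qed.

Lemma is_derive_trig N a x :
  is_derive x 1 (fun y => Re (trig N a y)) (Re (trig N (dxc a) x)) /\
  is_derive x 1 (fun y => Im (trig N a y)) (Im (trig N (dxc a) x)).
Proof.
have hZ (r : R) (f : R -> R) d : is_derive x 1 f d -> is_derive x 1 (fun y => r * f y) (r * d).
  exact: is_deriveZ.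
split.
  rewrite Re_sum; under eq_fun do rewrite Re_sum.
  apply: is_derive_sum_pt => k; rewrite /dxc; case: (a k) => u v.
  have h1 := hZ u _ _ (is_derive_cosk k x).
  have h2 := hZ (- v) _ _ (is_derive_sink k x).
  rewrite (_ : Re _ = u * - (k%:~R * sin (k%:~R * x)) +
    - v * (k%:~R * cos (k%:~R * x))); last by rewrite /=; ring.
  rewrite (_ : (fun y => _) = (fun y => u * cos (k%:~R * y) + - v * sin (k%:~R * y))).
    exact: is_deriveD h1 h2.
  by apply/funext => y /=; ring.
rewrite Im_sum; under eq_fun do rewrite Im_sum.
apply: is_derive_sum_pt => k; rewrite /dxc; case: (a k) => u v.
have h1 := hZ u _ _ (is_derive_sink k x).
have h2 := hZ v _ _ (is_derive_cosk k x).
rewrite (_ : Im _ = u * (k%:~R * cos (k%:~R * x)) +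
  v * - (k%:~R * sin (k%:~R * x))); last by rewrite /=; ring.
exact: is_deriveD h1 h2.
Qed.

(** The imaginary part of the sum vanishes identically, hence so does its
    derivative, and the formal derivative is real. *)
Lemma trig_derive1 (v : R -> R) N a : rc v = trig N a ->
  rc (derive1 v) = trig N (dxc a).
Proof.
move=> vE; apply/funext => x; have [hR hI] := is_derive_trig N a x.
have vR : v = (fun y => Re (trig N a y)) by rewrite -vE; apply/funext.
have vI : (fun y => Im (trig N a y)) = (fun=> 0) by rewrite -vE; apply/funext.
apply: complex_eq => /=; first by rewrite {1}vR derive1E; have [_ ->] := hR.
rewrite vI in hI; have [_ <-] := hI; have [_ ->] := is_derive_cst (0 : R) x (1 : R).
by [].
Qed.

Lemma trigM N a b x :
  trig N a x * trig N b x = \sum_(p <- zs N) \sum_(q <- zs N) a p * b q * expik (p + q) x.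
Proof.
rewrite mulr_suml; apply: eq_bigr => p _; rewrite mulr_sumr; apply: eq_bigr => q _.
by rewrite expikD mulrACA.
Qed.

Lemma fourier_coef_trigM N a b k :
  fourier_coef (fun x => trig N a x * trig N b x) k = conv N a b k.
Proof.
rewrite /fourier_coef (cintegral_eq (h := fun x => \sum_(p <- zs N) \sum_(q <- zs N)
    a p * b q * expik (p + q - k) x)); last first.
  move=> x _; rewrite trigM mulr_sumr; apply: eq_bigr => p _; rewrite mulr_sumr.
  by apply: eq_bigr => q _; rewrite mulrCA -expikD [- k + _]addrC.
rewrite cintegral_sum; last by move=> p; apply: cintg_sum => q; apply/cintgZ/cintg_expik.
rewrite /conv mulr_sumr; apply: eq_bigr => p _.
rewrite cintegral_sum; last by move=> q; apply/cintgZ/cintg_expik.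
rewrite mulr_sumr; apply: eq_bigr => q _.
rewrite cintegralZ; last exact: cintg_expik.
rewrite cintegral_expik subr_eq0.
by case: eqP => _; rewrite ?mulr0n ?mulr0// !mulr1n [_ * _%:C]mulrC pi2VK.
Qed.

End Trigonometric.

(** * The Galerkin system for the Fourier coefficients *)

Section Galerkin.
Variable R : realType.
Local Notation nm := (@Normc.normc R).
Local Notation Re := complex.Re.
Local Notation Im := complex.Im.
Implicit Types (g h : R -> R[i]) (a b c : int -> R[i]) (k : int) (x : R).

Lemma expikDr k x y : expik k (x + y) = expik k x * expik k y.
Proof.
by rewrite /expik mulrDr cosD sinD; apply: complex_eq; rewrite ?Re_mul ?Im_mul /=; ring.
Qed.

Lemma expikMn k n x : expik k (n%:R * x) = expik k x ^+ n.
Proof.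
elim: n => [|n IH]; last by rewrite -[n.+1]addn1 natrD mulrDl mul1r expikDr IH exprD.
by rewrite mul0r /expik mulr0 cos0 sin0.
Qed.

Lemma cos_double x : cos (x *+ 2) = 1 - (sin x ^+ 2) *+ 2 :> R.
Proof.
by rewrite mulr2n cosD -!expr2 -(cos2Dsin2 x); move: (cos x) (sin x) => u v; ring.
Qed.

Lemma sin_double x : sin (x *+ 2) = sin x * cos x *+ 2 :> R.
Proof. by rewrite mulr2n sinD; move: (cos x) (sin x) => u v; ring. Qed.

Lemma expik_2pi k : expik k (pi *+ 2) = 1 :> R[i].
Proof.
rewrite /expik mulrnAr cos_double sin_double sin_kpi.
by rewrite mul0r mul0rn expr0n mul0rn subr0.
Qed.

Lemma expik_neq1 k (n : nat) : k != 0 -> (absz k < n)%N ->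
  expik k (pi *+ 2 / n%:R) != 1 :> R[i].
Proof.
move=> k0 kn; apply/eqP => /(congr1 (@complex.Re R)) /=.
have n0 : 0 < n%:R :> R by rewrite ltr0n (leq_trans _ kn).
rewrite mulrnAl mulrnAr cos_double.
have s0 (m : nat) : (0 < m < n)%N -> sin (m%:R * (pi / n%:R)) != 0 :> R.
  move=> /andP[m0 mn]; rewrite gt_eqF// sin_gt0_pi//.
  rewrite mulr_gt0 ?ltr0n ?divr_gt0 ?pi_gt0//= mulrCA gtr_pMr ?pi_gt0//.
  by rewrite ltr_pdivrMr// mul1r ltr_nat.
have : sin (k%:~R * (pi / n%:R)) != 0 :> R.
  case: k k0 kn => m k0 kn; first by apply: s0; rewrite kn andbT; case: m k0 {kn}.
  by rewrite NegzE rmorphN mulNr sinN oppr_eq0; apply: (s0 m.+1).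
move=> /negP h /eqP; rewrite -subr_eq0 addrAC subrr sub0r oppr_eq0 mulrn_eq0/= sqrf_eq0.
exact/negP/negP.
Qed.

Lemma sum_expik N k : (absz k <= N.*2)%N ->
  \sum_(j < N.*2.+1) expik k (j%:R * (pi *+ 2 / N.*2.+1%:R)) =
  (N.*2.+1)%:R *+ (k == 0) :> R[i].
Proof.
move=> kN; have [->|k0] := eqVneq k 0.
  under eq_bigr do rewrite expik0.
  by rewrite sumr_const card_ord mulr1n.
under eq_bigr do rewrite expikMn.
set z := expik k _; have z1 : z - 1 != 0 by rewrite subr_eq0 expik_neq1.
apply: (mulfI z1); rewrite -subrX1 /z -expikMn mulr0n mulr0.
by rewrite mulrC divfK ?pnatr_eq0// expik_2pi subrr.
Qed.

(** Discrete Fourier inversion at [2 N + 1] equidistant points, which recovers the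
    coefficients without integration. *)
Lemma dft N a k : (absz k <= N)%N ->
  \sum_(j < N.*2.+1) (N.*2.+1%:R^-1 * expik (- k) (j%:R * (pi *+ 2 / N.*2.+1%:R))) *
     trig N a (j%:R * (pi *+ 2 / N.*2.+1%:R)) = a k.
Proof.
move=> kN; pose n := N.*2.+1; pose x j := (j%:R * (pi *+ 2 / N.*2.+1%:R)) : R.
have n0 : n%:R != 0 :> R[i] by rewrite pnatr_eq0.
transitivity (\sum_(l <- zs N) n%:R^-1 * a l * \sum_(j < n) expik (- k + l) (x j)).
  under [RHS]eq_bigr do rewrite mulr_sumr.
  rewrite exchange_big; apply: eq_bigr => j _; rewrite mulr_sumr.
  by apply: eq_bigr => l _; rewrite expikD /x /n; ring.
transitivity (\sum_(l <- zs N) a l *+ (l == k)); last by rewrite sum_pick /cut kN.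
rewrite big_seq [RHS]big_seq; apply: eq_bigr => l; rewrite mem_zs => lN.
rewrite sum_expik; last by lia.
rewrite [- k + l]addrC subr_eq0; case: eqP => _; last by rewrite !mulr0n mulr0.
by rewrite !mulr1n mulrAC mulVf ?mul1r.
Qed.

(** The real part is differentiated termwise; the imaginary part vanishes, hence
    so does its derivative. *)
Lemma dt_trig (T t : R) N (v : R -> R -> R) (a : R -> int -> R[i]) b :
  0 < T -> t \in `[0, T] ->
  (forall s, s \in `[0, T] -> rc (v s) = trig N (a s)) ->
  (forall k, (absz k <= N)%N -> has_dtc T (fun s => a s k) t (b k)) ->
  rc (dt T v t) = trig N b.
Proof.
move=> T0 tT va ab; apply/funext => x.
have dtr : has_dtc T (fun s => rc (v s) x) t (trig N b x).
  apply: (@has_dtc_eq _ T (fun s => trig N (cut N (a s)) x)) => //.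
    by move=> s sT; rewrite trig_cut va.
  rewrite -(trig_cut N b); apply: has_dtc_sum => k; rewrite /cut.
  under eq_fun do rewrite mulrC; rewrite mulrC; apply: has_dtcZ.
  by case: ifP => [/ab//|_]; exact: has_dtc_cst.
have [hR hI] := dtr.
apply: complex_eq => /=.
  by apply: cvg_lim => //; have := tnear_proper T0 tT; exact.
exact: has_dt_unique (has_dt_cst _ _ _) hI.
Qed.

(** The coefficients of [- u_xxx] and of [- P_N ((v w)_x) / 2]. *)
Definition airy b k : R[i] := - dxc (dxc (dxc b)) k.

Definition burgers N b c : int -> R[i] := cut N (fun k => - (dxc (conv N b c) k / 2)).

(** [v v_x = (v^2)_x / 2]. *)
Lemma conv_dxc N a k : conv N a (dxc a) k = dxc (conv N a a) k / 2.
Proof.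
apply: (mulIf (x := 2)); first by rewrite pnatr_eq0.
rewrite divfK ?pnatr_eq0// mulr_natr mulr2n {1}convC /conv -big_split /dxc mulr_sumr.
apply: eq_bigr => p _; rewrite -big_split mulr_sumr; apply: eq_bigr => q _ /=.
rewrite -mulrnDl mulrnAr; case: eqP => // <-; rewrite !mulr1n.
have -> : 0 +i* (p + q)%:~R = (0 +i* p%:~R) + (0 +i* q%:~R) :> R[i].
  by rewrite rmorphD; apply: complex_eq => /=; rewrite ?addr0.
by ring.
Qed.

Lemma cintegral_inner g k : inner g (expik k) = cintegral (fun x => expik (- k) x * g x).
Proof. by apply: cintegral_eq => x _; rewrite expikN mulrC. Qed.

Lemma pi2C_neq0 : (pi *+ 2)%:C != 0 :> R[i].
Proof. by apply/eqP => /(congr1 (@complex.Re R)) /= /eqP; rewrite (negbTE (pi2_neq0 R)). Qed.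

Lemma cintegral_fourier g k :
  cintegral (fun x => expik (- k) x * g x) = (pi *+ 2)%:C * fourier_coef g k.
Proof. by rewrite /fourier_coef mulrA -rmorphM divff ?pi2_neq0// mul1r. Qed.

Lemma cintg_eq g h : g =1 h -> cintg g -> cintg h.
Proof. by move=> /funext ->. Qed.

Lemma cintg_expik_trig N a k : cintg (fun x => expik k x * trig N a x).
Proof.
apply: (@cintg_eq (fun x => \sum_(l <- zs N) a l * expik (k + l) x)).
  by move=> x; rewrite trig_mul_expik.
by apply: cintg_sum => l; apply/cintgZ/cintg_expik.
Qed.

Lemma cintg_expik_trigM N a b k :
  cintg (fun x => expik k x * (trig N a x * trig N b x)).
Proof.
apply: (@cintg_eq (fun x => \sum_(p <- zs N) a p * (expik (k + p) x * trig N b x))).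
  move=> x; rewrite mulrA trig_mul_expik mulr_suml.
  by apply: eq_bigr => p _; rewrite mulrA.
by apply: cintg_sum => p; apply/cintgZ/cintg_expik_trig.
Qed.

(** Differentiability of the coefficients comes from that of point values by
    [dft]; testing the Galerkin equation against [e^{ikx}] gives their
    derivatives. *)
Lemma galerkin_coef (T : R) N (u0 : R -> R) (u : R -> R -> R) :
  0 < T -> galerkin N T u0 u ->
  let a s := fourier_coef (rc (u s)) in
  [/\ forall s, s \in `[0, T] -> rc (u s) = trig N (a s),
      forall s k, s \in `[0, T] -> ~~ (absz k <= N)%N -> a s k = 0,
      forall k, a 0 k = cut N (fourier_coef (rc u0)) k &
      forall t k, t \in `[0, T] ->
        has_dtc T (fun s => a s k) t (airy (a t) k + burgers N (a t) (a t) k)].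
Proof.
move=> T0 [uS du ueq u_0] a.
have uT s : s \in `[0, T] -> rc (u s) = trig N (a s) by move=> /uS; exact: SN_trig.
have aE s k : s \in `[0, T] -> a s k = cut N (a s) k.
  by move=> sT; rewrite -fourier_coef_trig -uT.
split => //.
- by move=> s k sT /negbTE kN; rewrite aE// /cut kN.
- move=> k; rewrite /a u_0 -fourier_coef_trig; congr fourier_coef.
  by apply/funext => x; rewrite /trig -sum_freq.
move=> t k tT.
pose x (j : nat) : R := j%:R * (pi *+ 2 / N.*2.+1%:R).
pose b l : R[i] := \sum_(j < N.*2.+1) (N.*2.+1%:R^-1 * expik (- l) (x j)) *
  (dt T u t (x j))%:C.
have ab l : (absz l <= N)%N -> has_dtc T (fun s => a s l) t (b l).
  move=> lN; apply: (@has_dtc_eq _ T (fun s => \sum_(j < N.*2.+1)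
    (N.*2.+1%:R^-1 * expik (- l) (x j)) * (u s (x j))%:C)) => //.
    move=> s sT; rewrite -[RHS](dft (a s) lN); apply: eq_bigr => j _.
    by rewrite -uT.
  apply: has_dtc_sum => j; apply: has_dtcZ; split=> /=; last exact: has_dt_cst.
  exact: du.
have dtE := dt_trig T0 tT uT ab.
have duE := trig_derive1 (uT t tT).
have d3E := trig_derive1 (trig_derive1 duE).
have eq l : (absz l <= N)%N -> b l = airy (a t) l + burgers N (a t) (a t) l.
  move=> lN; have := ueq t _ tT (SN_expik R lN); rewrite cintegral_inner.
  rewrite (cintegral_eq (h := fun y => expik (- l) y * trig N b y +
    (expik (- l) y * (trig N (a t) y * trig N (dxc (a t)) y) +
     expik (- l) y * trig N (dxc (dxc (dxc (a t)))) y))); last first.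
    move=> y _; rewrite -dtE -duE -d3E -uT// -!mulrDr; congr (_ * _).
    by rewrite /rc addrA -rmorphM -!rmorphD.
  have cD : cintg (fun y => expik (- l) y * trig N b y) by exact: cintg_expik_trig.
  have cM : cintg (fun y => expik (- l) y * (trig N (a t) y * trig N (dxc (a t)) y)).
    exact: cintg_expik_trigM.
  have cD3 : cintg (fun y => expik (- l) y * trig N (dxc (dxc (dxc (a t)))) y).
    exact: cintg_expik_trig.
  rewrite !cintegralD//; last exact: cintgD.
  rewrite !cintegral_fourier fourier_coef_trigM !fourier_coef_trig.
  rewrite -!mulrDr => /eqP; rewrite mulf_eq0 (negbTE pi2C_neq0) /= => /eqP.
  rewrite conv_dxc /burgers /airy /cut lN => E.
  by apply: (addIr (dxc (conv N (a t) (a t)) l / 2 + dxc (dxc (dxc (a t))) l));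
    rewrite E; ring.
have [kN|kN] := boolP (absz k <= N)%N; first by rewrite -eq//; exact: ab.
rewrite /burgers /cut (negbTE kN) addr0 /airy /dxc aE// /cut (negbTE kN) !mulr0 oppr0.
apply: (@has_dtc_eq _ T (fun=> 0)) => //; last exact: has_dtc_cst.
by move=> s sT; rewrite aE// /cut (negbTE kN).
Qed.

End Galerkin.

(** * Uniqueness of Fourier coefficients *)

Section Uniqueness.
Variable R : realType.
Local Notation nm := (@Normc.normc R).
Local Notation Re := complex.Re.
Local Notation Im := complex.Im.
Local Notation mu := (@lebesgue_measure R).
Local Notation Ipi := (@Ipi R).
Local Notation intg f := (mu.-integrable Ipi (EFin \o f)).
Implicit Types (h : R -> R) (x y c : R) (k : int).

Lemma intg_mul h (phi : R -> R) (B : R) : intg h ->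
  measurable_fun (Ipi : set (measurableTypeR R)) phi ->
  (forall x, `|phi x| <= B) -> intg (fun x => h x * phi x).
Proof.
move=> hi mphi phiB.
have bphi : [bounded phi x | x in Ipi].
  by exists B; split; [exact: num_real|move=> M BM x _ /=; rewrite (le_trans (phiB x))// ltW].
have := integrableMl (@measurable_Ipi R) hi mphi bphi.
by apply: eq_integrable; [exact: measurable_Ipi|move=> x _ /=; rewrite EFinM].
Qed.

Lemma continuous_cos_shift c : continuous (fun x => cos (x - c)).
Proof.
move=> x; apply: continuous_comp; last exact: continuous_cos.
by apply: continuousB; [exact: cvg_id|exact: cst_continuous].
Qed.

Lemma continuous_measurable_Ipi (f : R -> R) : continuous f ->
  measurable_fun (Ipi : set (measurableTypeR R)) f.
Proof.
move=> cf; apply: (@measurable_funTS _ _ (measurableTypeR R)).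
exact: continuous_measurable_fun.
Qed.

Lemma cintg_mul_expik h (phi : R -> R) (B : R) k : intg h -> continuous phi ->
  (forall x, `|phi x| <= B) -> cintg (fun x => (h x * phi x)%:C * expik k x).
Proof.
move=> hi cphi phiB; have hphi := intg_mul hi (continuous_measurable_Ipi cphi) phiB.
split.
  apply: (@intg_eq _ (fun x => h x * phi x * cos (k%:~R * x))).
    by move=> x; rewrite Re_mul /= mul0r subr0.
  apply: (@intg_mul _ (fun x => cos (k%:~R * x)) 1 hphi) => // [|x]; last exact: cos_max.
  apply: continuous_measurable_Ipi; exact: continuous_cosk.
apply: (@intg_eq _ (fun x => h x * phi x * sin (k%:~R * x))).
  by move=> x; rewrite Im_mul /= mul0r addr0.
apply: (@intg_mul _ (fun x => sin (k%:~R * x)) 1 hphi) => // [|x]; last exact: sin_max.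
apply: continuous_measurable_Ipi; exact: continuous_sink.
Qed.

Lemma cosX_le1 c n x : `|cos (x - c) ^+ n| <= 1.
Proof. by rewrite normrX exprn_ile1// cos_max. Qed.

Lemma continuous_cosX c n : continuous (fun x => cos (x - c) ^+ n).
Proof.
move=> x; apply: (@continuous_comp _ _ _ (fun y => cos (y - c)) (fun y => y ^+ n)).
  exact: continuous_cos_shift.
exact: exprn_continuous.
Qed.

(** Multiplication by [cos (x - c)] shifts the frequency by one in both
    directions. *)
Lemma cosX_orthogonal h c n k : intg h ->
  (forall l, cintegral (fun x => (h x)%:C * expik l x) = 0) ->
  cintegral (fun x => (h x * cos (x - c) ^+ n)%:C * expik k x) = 0.
Proof.
move=> hi h0; elim: n k => [|n IH] k.
  by rewrite -(h0 k); apply: cintegral_eq => x _; rewrite expr0 mulr1.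
pose al : R[i] := (cos c / 2) +i* (- (sin c / 2)); pose be := conjc al.
rewrite (cintegral_eq (h := fun x =>
  al * ((h x * cos (x - c) ^+ n)%:C * expik (k + 1) x) +
  be * ((h x * cos (x - c) ^+ n)%:C * expik (k - 1) x))); last first.
  move=> x _; rewrite !expikD exprSr mulrA (rmorphM (real_complex R) (h x * cos (x - c) ^+ n)) /=.
  move: (h x * _)%:C (expik k x) => z w.
  have -> : (cos (x - c))%:C = al * expik 1 x + be * expik (-1) x.
    by rewrite expikN /expik mul1r cosB /be /al; apply: complex_eq => /=; field.
  by clearbody al be; ring.
have ci l : cintg (fun x => (h x * cos (x - c) ^+ n)%:C * expik l x).
  exact: cintg_mul_expik hi (@continuous_cosX c _) (@cosX_le1 c _).
rewrite (cintegralD (cintgZ al (ci (k + 1))) (cintgZ be (ci (k - 1)))).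
by rewrite (cintegralZ al (ci _)) (cintegralZ be (ci _)) !IH !mulr0 addr0.
Qed.

Lemma poly_cos_orthogonal h c (p : {poly R}) : intg h ->
  (forall l, cintegral (fun x => (h x)%:C * expik l x) = 0) ->
  \int[mu]_(x in Ipi) (h x * p.[cos (x - c)]) = 0.
Proof.
move=> hi h0.
have ci i : cintg (fun x => (h x * cos (x - c) ^+ i)%:C * expik 0 x).
  exact: cintg_mul_expik hi (@continuous_cosX c _) (@cosX_le1 c _).
have : cintegral (fun x => \sum_(i < size p) (p`_i)%:C *
    ((h x * cos (x - c) ^+ i)%:C * expik 0 x)) = 0.
  rewrite cintegral_sum => [|i]; last exact: cintgZ.
  by rewrite big1 // => i _; rewrite cintegralZ// cosX_orthogonal// mulr0.
move=> /(congr1 (@complex.Re R)) /= <-; apply: eq_Rintegral => x _.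
rewrite horner_coef mulr_sumr Re_sum; apply: eq_bigr => i _.
by rewrite expik0 mulr1 /= mul0r subr0 mulrCA.
Qed.

Lemma onem_expr_ge (z : R) n : 0 <= z <= 1 -> 1 - n%:R * z <= (1 - z) ^+ n.
Proof.
move=> /andP[z0 z1]; elim: n => [|n IH]; first by rewrite mul0r subr0.
rewrite exprS; have [h|h] := leP 0 (1 - n%:R * z); last first.
  apply: (@le_trans _ _ 0); last by rewrite mulr_ge0 ?exprn_ge0 ?subr_ge0.
  rewrite -[n.+1]addn1 natrD mulrDl; lra.
apply: (@le_trans _ _ ((1 - z) * (1 - n%:R * z))); last by rewrite ler_wpM2l// subr_ge0.
rewrite -[n.+1]addn1 natrD -subr_ge0 (_ : _ - _ = n%:R * z ^+ 2); last by ring.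
by rewrite mulr_ge0 ?ler0n ?sqr_ge0.
Qed.

Lemma onem_expr_le (z : R) n : 0 <= z <= 1 -> (1 - z) ^+ n * (1 + n%:R * z) <= 1.
Proof.
move=> /andP[z0 z1]; elim: n => [|n IH]; first by rewrite mul0r addr0 mulr1.
apply: le_trans IH; rewrite exprSr -mulrA ler_wpM2l ?exprn_ge0 ?subr_ge0//.
rewrite -[n.+1]addn1 natrD -subr_ge0 (_ : _ - _ = (n%:R + 1) * z ^+ 2); last by ring.
by rewrite mulr_ge0 ?addr_ge0 ?sqr_ge0.
Qed.

(** These polynomials converge boundedly on [[0, 1]] to a step function with the
    step at [1/2]: by Bernoulli's inequality, [step y n] differs from [1] by at
    most [(2 y)^n], and is at most [(2 y)^(-n)]. *)
Definition step (y : R) n := (1 - y ^+ n) ^+ (2 ^ n)%N.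

Lemma step_itv y n : 0 <= y <= 1 -> 0 <= step y n <= 1.
Proof.
move=> /andP[y0 y1]; have h0 : 0 <= y ^+ n by exact: exprn_ge0.
have h1 : y ^+ n <= 1 by exact: exprn_ile1.
by rewrite /step exprn_ge0 ?exprn_ile1// ?subr_ge0// gerBl.
Qed.

Lemma step_cvg1 y : 0 <= y < 2^-1 -> step y n @[n --> \oo] --> (1 : R).
Proof.
move=> /andP[y0 y1]; have y2 : `|2 * y| < 1 by rewrite ger0_norm ?mulr_ge0//; lra.
apply: (@squeeze_cvgr _ _ _ _ (fun n => 1 - (2 * y) ^+ n) (cst 1)).
- apply: nearW => n; have yn : 0 <= y ^+ n <= 1.
    by rewrite exprn_ge0// exprn_ile1//; lra.
  have /andP[_ ->] : 0 <= step y n <= 1 by apply: step_itv; rewrite y0/=; lra.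
  by rewrite andbT exprMn -natrX; exact: onem_expr_ge.
- rewrite -[X in _ --> X]subr0; apply: cvgB; [exact: cvg_cst|exact: cvg_expr].
- exact: cvg_cst.
Qed.

Lemma step_cvg0 y : 2^-1 < y <= 1 -> step y n @[n --> \oo] --> (0 : R).
Proof.
move=> /andP[y1 y2]; have y0 : 0 < y by lra.
have hy : 1 < 2 * y by lra.
have y2' : `|(2 * y)^-1| < 1 by rewrite ger0_norm ?invr_ge0 ?invf_lt1//; lra.
apply: (@squeeze_cvgr _ _ _ _ (cst 0) (fun n => (2 * y)^-1 ^+ n)).
- apply: nearW => n; have yn : 0 <= y ^+ n <= 1.
    by rewrite exprn_ge0 ?exprn_ile1 ?(ltW y0).
  have /andP[-> _] : 0 <= step y n <= 1 by apply: step_itv; rewrite (ltW y0).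
  rewrite /= exprVn -[leRHS]mul1r ler_pdivlMr; last by rewrite exprn_gt0//; lra.
  apply: le_trans (onem_expr_le (2 ^ n)%N yn).
  rewrite ler_wpM2l ?exprn_ge0 ?subr_ge0//; first by case/andP: yn.
  by rewrite natrX -exprMn lerDr.
- exact: cvg_cst.
- exact: cvg_expr.
Qed.

End Uniqueness.

Section UniquenessTheorem.
Variable R : realType.
Local Notation mu := (@lebesgue_measure R).
Local Notation Ipi := (@Ipi R).
Local Notation intg f := (mu.-integrable Ipi (EFin \o f)).
Implicit Types (h : R -> R) (x y : R).

Lemma ae_avoid (x y z : R) (P : R -> Prop) :
  (forall t, t != x -> t != y -> t != z -> P t) -> {ae mu, forall t, P t}.
Proof.
move=> h; exists ([set x] `|` [set y] `|` [set z]); split.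
- by do 2?apply: measurableU; exact: measurable_set1.
- apply: countable_lebesgue_measure0; apply: finite_set_countable.
  by rewrite !finite_setU; do !split; exact: finite_set1.
- move=> t /= nP; apply: contrapT => ntt; apply: nP; apply: h.
  + by apply/eqP => tx; apply: ntt; left; left.
  + by apply/eqP => tx; apply: ntt; left; right.
  + by apply/eqP => tx; apply: ntt; right.
Qed.

Lemma cos_arc x y : - pi < x -> x < pi -> - pi < y -> y < pi ->
  (y < x -> cos ((x + pi) / 2) < cos (y - (x - pi) / 2)) /\
  (x < y -> cos (y - (x - pi) / 2) < cos ((x + pi) / 2)).
Proof.
move=> x1 x2 y1 y2;
have h (a b : R) : 0 <= a -> a < b -> b <= pi -> cos b < cos a.
  move=> a0 ab bp; rewrite ltr_cos// in_itv/=.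
    by rewrite a0 (le_trans (ltW ab)).
  by rewrite bp (le_trans a0)// ltW.
split=> yx.
  have [s|s] := leP 0 (y - (x - pi) / 2); first by apply: h => //; lra.
  by rewrite -(cosN (y - _)); apply: h; lra.
have [s|s] := leP (y - (x - pi) / 2) pi; first by apply: h => //; lra.
rewrite -(cosN (y - _)) -(cosD2pi (- _)); apply: h; rewrite ?[pi *+ 2]mulr2n; lra.
Qed.

(** The arc from [- pi] to [x] is where [cos (y - c)] exceeds [cos r] for the
    midpoint [c] and the half-length [r]; its indicator function is therefore,
    up to finitely many points, a bounded limit of polynomials in
    [cos (y - c)]. *)
Lemma integral_prefix0 h x : intg h -> - pi < x < pi ->
  (forall l, cintegral (fun y => (h y)%:C * expik l y) = 0) ->
  \int[mu]_(y in `[- pi, x]) h y = 0.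
Proof.
move=> hi xpi h0; pose c := (x - pi) / 2; pose dl := cos ((x + pi) / 2).
pose Y y := 2^-1 + (cos (y - c) - dl) / 4.
pose p n : {poly R} := (1 - (2^-1%:P + ('X - dl%:P) * 4^-1%:P) ^+ n) ^+ (2 ^ n)%N.
have pE n y : (p n).[cos (y - c)] = step (Y y) n.
  by rewrite /p /step /Y !hornerE.
have Y01 y : 0 <= Y y <= 1.
  have := cos_max (y - c); have := cos_max ((x + pi) / 2); rewrite -/dl /Y.
  by rewrite !ler_norml => /andP[a1 a2] /andP[b1 b2]; apply/andP; split; lra.
pose phi : R -> R := \1_(`]x, +oo[%classic).
have phiE y : phi y = if y <= x then 0 else 1.
  by rewrite /phi indicE mem_setE in_itv/= andbT ltNge; case: ifP.
have mphi : measurable_fun (Ipi : set (measurableTypeR R)) phi.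
  exact: measurable_indic.
have phi1 y : `|phi y| <= 1 by rewrite phiE; case: ifP => _; rewrite ?normr0 ?normr1.
have hphi := intg_mul hi mphi phi1.
have cY : continuous Y.
  move=> y; apply: cvgD; first exact: cvg_cst.
  apply: cvgM; last exact: cvg_cst.
  by apply: cvgB; [exact: continuous_cos_shift|exact: cvg_cst].
have cstep n : continuous (fun y => step (Y y) n).
  move=> y; apply: (@continuous_comp _ _ _ (fun y => 1 - Y y ^+ n) (fun z => z ^+ (2 ^ n)%N)).
    apply: cvgB; first exact: cvg_cst.
    by apply: (@continuous_comp _ _ _ Y (fun z => z ^+ n)); [exact: cY|exact: exprn_continuous].
  exact: exprn_continuous.
have step1 n y : `|step (Y y) n| <= 1.
  by have /andP[s0 s1] := step_itv n (Y01 y); rewrite ger0_norm.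
have hstep n : intg (fun y => h y * step (Y y) n).
  by apply: intg_mul (step1 n) => //; exact: continuous_measurable_Ipi.
have dcv := @dominated_convergence _ (measurableTypeR R) R mu Ipi (@measurable_Ipi R)
  (fun n y => (h y * step (Y y) n)%:E) (fun y => (h y * phi y)%:E)
  (fun y => `|h y|%:E) (fun n => measurable_int mu (hstep n)) (measurable_int mu hphi).
have aecv : {ae mu, forall y, Ipi y ->
    (h y * step (Y y) n)%:E @[n --> \oo] --> (h y * phi y)%:E}.
  apply: (@ae_avoid (- pi) x pi) => y y1 y2 y3 /=; rewrite /Defs.Ipi /= in_itv/= => /andP[y4 y5].
  have ypi : - pi < y < pi by rewrite !lt_neqAle y4 y5 y3 eq_sym y1.
  case/andP: (xpi) => x3 x4; case/andP: (ypi) => y6 y7.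
  have [c1 c2] := cos_arc x3 x4 y6 y7.
  apply: cvg_EFin; first exact: nearW.
  apply: cvgM; first exact: cvg_cst.
  rewrite phiE; have [yx|xy] := leP y x.
    apply: step_cvg0; have /andP[_ ->] := Y01 y; rewrite andbT /Y ltrDl divr_gt0//.
    by rewrite subr_gt0; apply: c1; rewrite lt_neqAle y2.
  apply: step_cvg1; have /andP[-> _] := Y01 y; rewrite /= /Y -subr_gt0.
  rewrite (_ : _ - _ = (dl - cos (y - c)) / 4); last by ring.
  by rewrite divr_gt0// subr_gt0; exact: c2.
have idom : mu.-integrable Ipi (fun y => `|h y|%:E).
  exact: integrable_norm.
have dom : {ae mu, forall y n, Ipi y -> (`|(h y * step (Y y) n)%:E| <= `|h y|%:E)%E}.
  apply: aeW => y n _; rewrite abse_EFin lee_fin normrM ler_piMr//.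
have [_ _] := dcv aecv idom dom.
have int0 n : (\int[mu]_(y in Ipi) (h y * step (Y y) n)%:E = 0)%E.
  have fn := integrable_fin_num (@measurable_Ipi R) (hstep n).
  rewrite -[LHS]fineK; last exact: fn.
  have := poly_cos_orthogonal c (p n) hi h0; rewrite /Rintegral => pn.
  by congr EFin; rewrite -[RHS]pn; congr fine; apply: eq_integral => y _; rewrite pE.
rewrite (_ : (fun n => _) = cst 0%E); last by apply/funext => n; exact: int0.
move=> /(cvg_unique _ (cvg_cst _)) => /(_ (@ereal_hausdorff R)) hphi0.
have Rphi0 : \int[mu]_(y in Ipi) (h y * phi y) = 0 by rewrite /Rintegral -hphi0.
have Rh0 : \int[mu]_(y in Ipi) h y = 0.
  have := h0 0; rewrite (cintegral_eq (h := fun y => (h y)%:C)); last first.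
    by move=> y _; rewrite expik0 mulr1.
  by move=> /(congr1 (@complex.Re R)).
have sub : `[- pi, x]%classic `<=` Ipi.
  by apply: subset_itvl; rewrite bnd_simp ltW//; case/andP: xpi.
have -> : `[- pi, x]%classic = Ipi `&` [set y | y <= x].
  apply/seteqP; split=> y /=.
    by move=> yx; split; [exact: sub|move: yx; rewrite in_itv/= => /andP[]].
  by rewrite /Defs.Ipi /= !in_itv/= => -[/andP[-> _] ->].
rewrite Rintegral_mkcondr.
transitivity (\int[mu]_(y in Ipi) (h y - h y * phi y)).
  apply: eq_Rintegral => y _; rewrite patchE phiE; case: ifPn => [|].
    by rewrite inE /= => ->; rewrite mulr0 subr0.
  by rewrite notin_setE /= => /negP /negbTE ->; rewrite mulr1 subrr.
by rewrite RintegralB//; [rewrite Rh0 Rphi0 subrr|exact: measurable_Ipi].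
Qed.

(** Lebesgue's differentiation theorem recovers [h] from its primitive, which
    vanishes. *)
Theorem fourier_unique h : intg h ->
  (forall l, cintegral (fun y => (h y)%:C * expik l y) = 0) ->
  {ae mu, forall x, Ipi x -> h x = 0}.
Proof.
move=> hi h0; pose g := h \_ Ipi.
have gi (A : set (measurableTypeR R)) : measurable A -> mu.-integrable A (EFin \o g).
  move=> mA; apply: (@integrableS _ _ _ mu setT) => //.
  rewrite /g -restrict_EFin.
  exact: (integrable_mkcond (mu := mu) (EFin \o h) (@measurable_Ipi R)).1 hi.
have lg : locally_integrable [set: R] g.
  exact: integrable_locally (@measurable_Ipi R) hi.
have := @FTC1 R g (BLeft (- pi)) (fun y => gi _ (measurable_itv _)) lg.
move=> /= ae1; have ae2 := @ae_avoid (- pi) pi pi (fun t => t != - pi /\ t != pi)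
  (fun t t1 t2 _ => conj t1 t2).
move: ae1 ae2; apply: (@filterS2 _ _ (ae_filter_ringOfSetsType mu)) => x + [x1 x2].
rewrite /Defs.Ipi /= in_itv/= => hx /andP[x3 x4].
have xpi : - pi < x < pi by rewrite !lt_neqAle x3 x4 x2 eq_sym x1.
have [] := hx; first by rewrite lte_fin; case/andP: xpi.
have gx : g x = h x by rewrite /g patchE mem_set//= /Defs.Ipi /= in_itv/= x3 x4.
rewrite gx derive1E => _ <-.
rewrite (@near_eq_derive _ _ _ _ (cst 0)).
  by rewrite derive_cst.
have : \forall y \near x, y \in `]- pi, pi[ by apply: near_in_itvoo; rewrite in_itv.
apply: filterS => y; rewrite in_itv/= => ypi.
rewrite -[RHS](integral_prefix0 hi ypi h0); apply: eq_Rintegral => z.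
rewrite inE /= in_itv/= => /andP[z1 z2].
rewrite /g patchE mem_set//= /Defs.Ipi /= in_itv/= z1 (le_trans z2)// ltW//; by case/andP: ypi.
Qed.

End UniquenessTheorem.

(** * Absolutely convergent Fourier series *)

Section Inversion.
Variable R : realType.
Local Notation nm := (@Normc.normc R).
Local Notation Re := complex.Re.
Local Notation Im := complex.Im.
Local Notation mu := (@lebesgue_measure R).
Local Notation Ipi := (@Ipi R).
Local Notation intg f := (mu.-integrable Ipi (EFin \o f)).
Implicit Types (v : R -> R) (x y : R) (c : int -> R[i]) (k : int).

Definition cvgc (z : nat -> R[i]) (w : R[i]) :=
  (Re (z n) @[n --> \oo] --> Re w) /\ (Im (z n) @[n --> \oo] --> Im w).

Lemma cvgc_cst (w : R[i]) : cvgc (fun=> w) w.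
Proof. by split; exact: cvg_cst. Qed.

Lemma cvgcM z1 z2 (w1 w2 : R[i]) : cvgc z1 w1 -> cvgc z2 w2 ->
  cvgc (fun n => z1 n * z2 n) (w1 * w2).
Proof.
move=> [a1 a2] [b1 b2]; split.
  rewrite Re_mul; under eq_fun do rewrite Re_mul.
  by apply: cvgB; exact: cvgM.
rewrite Im_mul; under eq_fun do rewrite Im_mul.
by apply: cvgD; exact: cvgM.
Qed.

Lemma cvgc_sum I (s : seq I) (z : I -> nat -> R[i]) (w : I -> R[i]) :
  (forall i, cvgc (z i) (w i)) ->
  cvgc (fun n => \sum_(i <- s) z i n) (\sum_(i <- s) w i).
Proof.
move=> h; elim: s => [|i s [IH1 IH2]].
  by rewrite big_nil; under eq_fun do rewrite big_nil; exact: cvgc_cst.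
have [h1 h2] := h i.
rewrite big_cons; under eq_fun do rewrite big_cons; split.
  by rewrite Re_add; under eq_fun do rewrite Re_add; exact: cvgD.
by rewrite Im_add; under eq_fun do rewrite Im_add; exact: cvgD.
Qed.

Definition contc (g : R -> R[i]) :=
  continuous (fun x => Re (g x)) /\ continuous (fun x => Im (g x)).

Lemma contc_cst (w : R[i]) : contc (fun=> w).
Proof. by split; move=> x; exact: cvg_cst. Qed.

Lemma contcM g h : contc g -> contc h -> contc (fun x => g x * h x).
Proof.
move=> [a1 a2] [b1 b2]; split=> x.
  under [X in continuous_at _ X]eq_fun do rewrite Re_mul.
  by apply: cvgB; apply: cvgM; [exact: a1|exact: b1|exact: a2|exact: b2].
under [X in continuous_at _ X]eq_fun do rewrite Im_mul.
by apply: cvgD; apply: cvgM; [exact: a1|exact: b2|exact: a2|exact: b1].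
Qed.

Lemma contc_expik k : contc (@expik R k).
Proof. by split; [exact: continuous_cosk|exact: continuous_sink]. Qed.

Lemma contc_sum I (s : seq I) (g : I -> R -> R[i]) :
  (forall i, contc (g i)) -> contc (fun x => \sum_(i <- s) g i x).
Proof.
move=> h; elim: s => [|i s [IH1 IH2]].
  by under eq_fun do rewrite big_nil; exact: contc_cst.
have [h1 h2] := h i.
under eq_fun do rewrite big_cons; split=> x.
  under [X in continuous_at _ X]eq_fun do rewrite Re_add.
  by apply: cvgD; [exact: h1|exact: IH1].
under [X in continuous_at _ X]eq_fun do rewrite Im_add.
by apply: cvgD; [exact: h2|exact: IH2].
Qed.

Lemma contc_trig N c : contc (trig N c).
Proof.
by apply: contc_sum => k; apply: contcM; [exact: contc_cst|exact: contc_expik].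
Qed.

Lemma Re_le_nm (z : R[i]) : `|Re z| <= nm z.
Proof.
by case: z => a b /=; rewrite -sqrtr_sqr ler_sqrt ?addr_ge0 ?sqr_ge0// lerDl sqr_ge0.
Qed.

Lemma Im_le_nm (z : R[i]) : `|Im z| <= nm z.
Proof.
by case: z => a b /=; rewrite -sqrtr_sqr ler_sqrt ?addr_ge0 ?sqr_ge0// lerDr sqr_ge0.
Qed.

Lemma measurable_EFin_Ipi (f : R -> R) :
  measurable_fun (Ipi : set (measurableTypeR R)) f ->
  measurable_fun (Ipi : set (measurableTypeR R)) (EFin \o f).
Proof. by move=> mf; apply/measurable_EFinP. Qed.

Lemma bounded_convergence (F : nat -> R -> R) (G : R -> R) (B : R) :
  (forall n, continuous (F n)) -> (forall n x, `|F n x| <= B) ->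
  (forall x, F n x @[n --> \oo] --> G x) ->
  intg G /\ \int[mu]_(x in Ipi) F n x @[n --> \oo] --> \int[mu]_(x in Ipi) G x.
Proof.
move=> cF FB FG.
have iF n : intg (F n) by exact: continuous_intg.
have mG : measurable_fun (Ipi : set (measurableTypeR R)) G.
  apply: (@measurable_fun_cvg _ (measurableTypeR R) R _ F) => //.
  by move=> n; exact: continuous_measurable_Ipi.
have iB : intg (fun=> B) by apply: continuous_intg => x; exact: cvg_cst.
have dcv := @dominated_convergence _ (measurableTypeR R) R mu Ipi (@measurable_Ipi R)
  (fun n y => (F n y)%:E) (fun y => (G y)%:E)
  (fun y => B%:E) (fun n => measurable_int mu (iF n)).
have mEG := measurable_EFin_Ipi mG.
have ae1 : {ae mu, forall y, Ipi y -> (F n y)%:E @[n --> \oo] --> (G y)%:E}.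
  by apply: aeW => y _; apply: cvg_EFin; [exact: nearW|exact: FG].
have ae2 : {ae mu, forall y n, Ipi y -> (`|(F n y)%:E| <= B%:E)%E}.
  by apply: aeW => y n _; rewrite abse_EFin lee_fin.
have [iG _ cv] := dcv mEG ae1 iB ae2; split => //.
have fn := integrable_fin_num (@measurable_Ipi R) iG.
by apply: fine_cvg; rewrite fineK.
Qed.

Lemma cintegral_cvg (F : nat -> R -> R[i]) (G : R -> R[i]) (B : R) :
  (forall n, contc (F n)) -> (forall n x, nm (F n x) <= B) ->
  (forall x, cvgc (fun n => F n x) (G x)) ->
  cintg G /\ cvgc (fun n => cintegral (F n)) (cintegral G).
Proof.
move=> cF FB FG.
have [i1 c1] := @bounded_convergence (fun n x => Re (F n x)) (fun x => Re (G x)) B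
  (fun n => (cF n).1) (fun n x => le_trans (Re_le_nm _) (FB n x)) (fun x => (FG x).1).
have [i2 c2] := @bounded_convergence (fun n x => Im (F n x)) (fun x => Im (G x)) B
  (fun n => (cF n).2) (fun n x => le_trans (Im_le_nm _) (FB n x)) (fun x => (FG x).2).
by split.
Qed.

(** Symmetric partial sums are those of the series with terms
    [F (n + 1) + F (- n - 1)], which converges absolutely. *)
Lemma zs_sum_is_cvg (F : int -> R) (B : R) :
  (forall M, \sum_(k <- zs M) `|F k| <= B) -> cvgn (fun M => \sum_(k <- zs M) F k).
Proof.
move=> FB; pose u n := F n.+1%:Z + F (- n.+1%:Z).
have E (G : int -> R) M : \sum_(k <- zs M) G k =
    G 0 + \sum_(0 <= n < M) (G n.+1%:Z + G (- n.+1%:Z)).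
  elim: M => [|M IH]; first by rewrite sum_zs0 big_geq ?addr0.
  by rewrite sum_zsS IH big_nat_recr//= -addrA.
have : cvgn (series u).
  apply: normed_cvg; apply: nondecreasing_is_cvgn.
    by apply: nondecreasing_series => n _ _; exact: normr_ge0.
  exists B => _ [M _ <-]; apply: le_trans (FB M); rewrite E.
  rewrite -[leLHS]add0r lerD// /series /=; apply: ler_sum => n _.
  exact: ler_normD.
move=> cu; rewrite (_ : (fun M => _) = (fun M => F 0 + series u M)).
  by apply: is_cvgD => //; exact: is_cvg_cst.
by apply/funext => M; rewrite E.
Qed.

Lemma nm_trig N c x : nm (trig N c x) <= \sum_(k <- zs N) nm (c k).
Proof.
apply: le_trans (nm_sum _ _) _; apply: ler_sum => k _.
by rewrite Normc.normcM nm_expik mulr1.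
Qed.

Lemma trig_real N c x : (forall k, c (- k) = conjc (c k)) -> Im (trig N c x) = 0.
Proof.
move=> cc; have : trig N c x = conjc (trig N c x).
  rewrite /trig -[LHS]sum_zsN rmorph_sum; apply: eq_bigr => k _ /=.
  by rewrite rmorphM cc expikN.
by case: (trig N c x) => a b [] /= /eqP; rewrite -addr_eq0 -mulr2n mulrn_eq0/= => /eqP.
Qed.

Definition fsum c x : R := limn (fun M => Re (trig M c x)).

Lemma fsum_cvg c (B : R) x : (forall k, c (- k) = conjc (c k)) ->
  (forall M, \sum_(k <- zs M) nm (c k) <= B) ->
  cvgc (fun M => trig M c x) (fsum c x)%:C.
Proof.
move=> cc cB; split => /=; last first.
  by under eq_fun do rewrite trig_real//; exact: cvg_cst.
have cv : cvgn (fun M => \sum_(k <- zs M) Re (c k * expik k x)).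
  apply: (@zs_sum_is_cvg _ B) => M; apply: le_trans (cB M); apply: ler_sum => k _.
  by apply: le_trans (Re_le_nm _) _; rewrite Normc.normcM nm_expik mulr1.
rewrite /fsum (_ : (fun M => _) = (fun M => \sum_(k <- zs M) Re (c k * expik k x))) //.
by apply/funext => M; rewrite Re_sum.
Qed.

Lemma cintg_expik_rc v k : intg v -> cintg (fun x => expik k x * rc v x).
Proof.
move=> vi; split.
  apply: (@intg_eq _ (fun x => v x * cos (k%:~R * x))).
    by move=> x; rewrite Re_mul /= mulr0 subr0 mulrC.
  apply: (@intg_mul _ _ (fun x => cos (k%:~R * x)) 1 vi) => [|x]; last exact: cos_max.
  by apply: continuous_measurable_Ipi; exact: continuous_cosk.
apply: (@intg_eq _ (fun x => v x * sin (k%:~R * x))).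
  by move=> x; rewrite Im_mul /= mulr0 add0r mulrC.
apply: (@intg_mul _ _ (fun x => sin (k%:~R * x)) 1 vi) => [|x]; last exact: sin_max.
by apply: continuous_measurable_Ipi; exact: continuous_sink.
Qed.

Lemma fourier_coef_conj v k : intg v ->
  fourier_coef (rc v) (- k) = conjc (fourier_coef (rc v) k).
Proof.
move=> vi; have [_ h2] := cintg_expik_rc k vi.
rewrite /fourier_coef rmorphM; congr (_ * _); first by apply: complex_eq; rewrite //= oppr0.
rewrite opprK /cintegral; apply: complex_eq => /=.
  by apply: eq_Rintegral => x _; rewrite !mulr0 !subr0 rmorphN mulNr cosN.
rewrite -mulN1r -RintegralZl; [|exact: measurable_Ipi|].
  by apply: eq_Rintegral => x _; rewrite rmorphN [- _ * x]mulNr sinN cosN; ring.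
exact: (cintg_expik_rc (- k) vi).2.
Qed.

Lemma fourier_coefB v w k : intg v -> intg w ->
  fourier_coef (rc (fun x => v x - w x)) k = fourier_coef (rc v) k - fourier_coef (rc w) k.
Proof.
move=> vi wi; have h1 := cintg_expik_rc (- k) vi.
have h2 := cintgZ (-1) (cintg_expik_rc (- k) wi).
rewrite /fourier_coef -mulrBr; congr (_ * _).
rewrite -[X in _ - X]mul1r -mulNr -cintegralZ ?h2; last exact: cintg_expik_rc.
rewrite -(cintegralD h1 h2); apply: cintegral_eq => x _.
by rewrite /rc rmorphB; ring.
Qed.

(** Integrated term by term, the sum of the series has the coefficients of [v];
    hence [fourier_unique] applies to the difference. *)
Lemma fourier_inversion v (B : R) : intg v ->
  (forall M, \sum_(k <- zs M) nm (fourier_coef (rc v) k) <= B) ->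
  {ae mu, forall x, Ipi x -> v x = fsum (fourier_coef (rc v)) x}.
Proof.
move=> vi vB; set c := fourier_coef _.
have cc k : c (- k) = conjc (c k) by exact: fourier_coef_conj.
have B0 : 0 <= B by apply: le_trans (vB 0%N); apply: sumr_ge0 => k _; exact: nm_ge0.
have cvf x := fsum_cvg x cc vB.
have nmB N x : nm (trig N c x) <= B by exact: le_trans (nm_trig _ _ _) (vB N).
have [fi _] := cintegral_cvg (contc_trig ^~ c) nmB cvf.
have fi' : intg (fsum c) by case: fi.
have fcoef k : fourier_coef (rc (fsum c)) k = c k.
  have [_ [c1 c2]] : cintg (fun x => expik (- k) x * rc (fsum c) x) /\
      cvgc (fun n => cintegral (fun x => expik (- k) x * trig n c x))
        (cintegral (fun x => expik (- k) x * rc (fsum c) x)).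
    apply: (@cintegral_cvg _ _ B) => [n|n x|x].
    - by apply: contcM; [exact: contc_expik|exact: contc_trig].
    - by rewrite Normc.normcM nm_expik mul1r.
    - by apply: cvgcM; [exact: cvgc_cst|exact: cvf].
  have ev n : (absz k <= n)%N ->
      cintegral (fun x => expik (- k) x * trig n c x) = (pi *+ 2)%:C * c k.
    by move=> kn; rewrite cintegral_fourier fourier_coef_trig /cut kn.
  apply: (mulfI (pi2C_neq0 R)); rewrite -cintegral_fourier.
  have near_ev : \forall n \near \oo, (absz k <= n)%N by exact: nbhs_infty_ge.
  apply: complex_eq.
    apply: (cvg_unique _ c1) => //=; apply: cvg_near_cst.
    by apply: filterS near_ev => n kn; exact: (congr1 (@complex.Re R) (ev n kn)).
  apply: (cvg_unique _ c2) => //=; apply: cvg_near_cst.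
  by apply: filterS near_ev => n kn; exact: (congr1 (@complex.Im R) (ev n kn)).
have hi : intg (fun x => v x - fsum c x).
  have := intgD vi (intgZ (-1) fi'); apply: intg_eq => x; by rewrite mulN1r.
have h0 l : cintegral (fun y => (v y - fsum c y)%:C * expik l y) = 0.
  have := fourier_coefB (- l) vi fi'; rewrite fcoef subrr => /eqP.
  rewrite /fourier_coef mulf_eq0 opprK => /orP[|/eqP <-].
    move=> /eqP/(congr1 (@complex.Re R)) /= /eqP.
    by rewrite invr_eq0 (negbTE (pi2_neq0 R)).
  by apply: cintegral_eq => y _; rewrite mulrC.
have := fourier_unique hi h0.
apply: (@filterS _ _ (ae_filter_ringOfSetsType mu)) => x h /h /eqP.
by rewrite subr_eq0 => /eqP.
Qed.

Lemma L2_intg v : L2 (rc v) -> intg v.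
Proof.
move=> [mv _ v2].
have mEv := measurable_EFin_Ipi mv.
have i1 : intg (fun=> 1 : R) by apply: continuous_intg => x; exact: cvg_cst.
have i2 : intg (fun x => v x ^+ 2).
  apply/integrableP; split.
    by apply/measurable_EFinP; exact: measurable_funX.
  apply: le_lt_trans v2; rewrite le_eqVlt; apply/orP; left; apply/eqP.
  apply: eq_integral => x _; rewrite /= expr0n addr0 sqrtr_sqr real_normK ?num_real//.
  by rewrite ger0_norm ?sqr_ge0.
apply: (le_integrable (@measurable_Ipi R) mEv _ (intgD i1 i2)) => x _ /=.
rewrite lee_fin [leRHS]ger0_norm ?addr_ge0 ?sqr_ge0//.
rewrite -[v x ^+ 2]real_normK ?num_real//.
rewrite -subr_ge0 (_ : _ - _ = (`|v x| - 2^-1) ^+ 2 + 3 / 4); last by field.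
by rewrite addr_ge0 ?sqr_ge0.
Qed.

Lemma L2_measurable v : L2 (rc v) ->
  measurable_fun (Ipi : set (measurableTypeR R)) v.
Proof. by case. Qed.

(** [u] and [u_x] are the sums of their series, and the products of the partial
    sums converge boundedly. *)
Lemma nonlinear_coef_cvg u ux (B : R) k : L2 (rc u) -> weak_dx (rc u) (rc ux) ->
  let c := fourier_coef (rc u) in
  (forall M, \sum_(k <- zs M) (1 + `|k%:~R|) * nm (c k) <= B) ->
  cvgc (fun M => conv M c (dxc c) k) (fourier_coef (rc (fun x => u x * ux x)) k).
Proof.
move=> u2 [ux2 uxE] c cB.
have ui := L2_intg u2; have uxi := L2_intg ux2.
have dE : fourier_coef (rc ux) = dxc c by apply/funext.
have cB1 M : \sum_(l <- zs M) nm (c l) <= B.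
  apply: le_trans (cB M); apply: ler_sum => l _.
  by rewrite ler_peMl ?nm_ge0// lerDl.
have cB2 M : \sum_(l <- zs M) nm (dxc c l) <= B.
  apply: le_trans (cB M); apply: ler_sum => l _.
  by rewrite /dxc Normc.normcM nm_imag ler_wpM2r ?nm_ge0// lerDr.
have cc l : c (- l) = conjc (c l) by exact: fourier_coef_conj.
have dcc l : dxc c (- l) = conjc (dxc c l) by rewrite -dE; exact: fourier_coef_conj.
have uB M : \sum_(l <- zs M) nm (fourier_coef (rc ux) l) <= B by rewrite dE.
have ae1 := fourier_inversion ui cB1.
have ae2 := fourier_inversion uxi uB; rewrite dE in ae2.
have B0 : 0 <= B by apply: le_trans (cB1 0%N); apply: sumr_ge0 => l _; exact: nm_ge0.
pose g x : R[i] := (fsum c x)%:C * (fsum (dxc c) x)%:C.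
have [gi gcv] : cintg (fun x => expik (- k) x * g x) /\
    cvgc (fun M => cintegral (fun x => expik (- k) x * (trig M c x * trig M (dxc c) x)))
      (cintegral (fun x => expik (- k) x * g x)).
  apply: (@cintegral_cvg _ _ (B * B)) => [n|n x|x].
  - by apply: contcM; [exact: contc_expik|apply: contcM; exact: contc_trig].
  - rewrite !Normc.normcM nm_expik mul1r ler_pM ?nm_ge0//.
      exact: le_trans (nm_trig _ _ _) (cB1 n).
    exact: le_trans (nm_trig _ _ _) (cB2 n).
  - apply: cvgcM; first exact: cvgc_cst.
    by apply: cvgcM; [exact: fsum_cvg cc cB1|exact: fsum_cvg dcc cB2].
have eqg : cintegral (fun x => expik (- k) x * rc (fun x => u x * ux x) x) =
    cintegral (fun x => expik (- k) x * g x).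
  have muux : measurable_fun (Ipi : set (measurableTypeR R)) (fun x => u x * ux x).
    by apply: measurable_funM; exact: L2_measurable.
  have ae12 : {ae mu, forall x, Ipi x -> rc (fun x => u x * ux x) x = g x}.
    move: ae1 ae2; apply: (@filterS2 _ _ (ae_filter_ringOfSetsType mu)) => x h1 h2 xI.
    by rewrite /rc (h1 xI) (h2 xI) /g -rmorphM.
  rewrite /cintegral; congr (_ +i* _); congr fine; apply: ae_eq_integral.
  - exact: measurable_Ipi.
  - apply/measurable_EFinP; rewrite (_ : (fun x => Re (_ * _)) =
      (fun x => cos ((- k)%:~R * x) * (u x * ux x))); last first.
      by apply/funext => x; rewrite Re_mul /= mulr0 subr0.
    apply: measurable_funM => //.
    by apply: continuous_measurable_Ipi; exact: continuous_cosk.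
  - by have [gi1 _] := gi; exact: measurable_int gi1.
  - apply: (@filterS _ _ (ae_filter_ringOfSetsType mu) _ _ _ ae12) => x h xI.
    exact: (congr1 (fun z => (complex.Re (expik (- k) x * z))%:E) (h xI)).
  - exact: measurable_Ipi.
  - apply/measurable_EFinP; rewrite (_ : (fun x => Im (_ * _)) =
      (fun x => sin ((- k)%:~R * x) * (u x * ux x))); last first.
      by apply/funext => x; rewrite Im_mul /= mulr0 add0r.
    apply: measurable_funM => //.
    by apply: continuous_measurable_Ipi; exact: continuous_sink.
  - by have [_ gi2] := gi; exact: measurable_int gi2.
  - apply: (@filterS _ _ (ae_filter_ringOfSetsType mu) _ _ _ ae12) => x h xI.
    exact: (congr1 (fun z => (complex.Im (expik (- k) x * z))%:E) (h xI)).
rewrite /fourier_coef eqg.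
rewrite (_ : (fun M => _) = (fun M => ((pi *+ 2)^-1)%:C *
    cintegral (fun x => expik (- k) x * (trig M c x * trig M (dxc c) x)))).
  by apply: cvgcM => //; exact: cvgc_cst.
by apply/funext => M; rewrite -fourier_coef_trigM.
Qed.

End Inversion.

(** * The exact solution in Fourier coefficients *)

Section SobolevNorm.
Variable R : realType.
Local Notation nm := (@Normc.normc R).
Local Notation Re := complex.Re.
Local Notation Im := complex.Im.
Implicit Types (c : int -> R[i]) (s : R) (k : int).

(** The analogue of [sob] for a real exponent. *)
Definition hsum s M c : R :=
  \sum_(k <- zs M) (1 + k%:~R ^+ 2) `^ s * nm (c k) ^+ 2.

Lemma hsum_term_ge0 s c k : 0 <= (1 + k%:~R ^+ 2) `^ s * nm (c k) ^+ 2.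
Proof. by rewrite mulr_ge0 ?powR_ge0 ?sqr_ge0. Qed.

Lemma hsum_le s c (e : R) M : 0 <= e -> (Hs_norm s c <= e%:E)%E -> hsum s M c <= e ^+ 2.
Proof.
move=> e0; rewrite /Hs_norm => he; rewrite -lee_fin.
have e2 : e%:E = sqrte (e ^+ 2)%:E by rewrite /= sqrtr_sqr ger0_norm.
rewrite e2 lee_sqrt ?lee_fin ?sqr_ge0// in he; apply: le_trans he.
apply: esum_ge; exists [set` zs M]; first by split => //; exact: finite_seq.
rewrite -fsbig_seq ?uniq_zs// /hsum; elim: (zs M) => [|k r IH].
  by rewrite !big_nil.
by rewrite !big_cons EFinD leeD.
Qed.

Lemma sob_le_hsum (n : nat) s M c : n%:R <= s -> sob n M c <= hsum s M c.
Proof.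
move=> ns; apply: ler_sum => k _; rewrite ler_wpM2r ?sqr_ge0//.
by rewrite -powR_mulrn ?ler_powR ?sqrp1_ge1// ltW ?sqrp1_gt0.
Qed.

Lemma hsum_ge_term s M c k : k \in zs M ->
  (1 + k%:~R ^+ 2) `^ s * nm (c k) ^+ 2 <= hsum s M c.
Proof.
move=> kM; rewrite /hsum (bigD1_seq k)//= ?uniq_zs// lerDl.
by apply: sumr_ge0 => l _; exact: hsum_term_ge0.
Qed.

Lemma hsumB_le s M (a b : int -> R[i]) :
  hsum s M a <= 2 * hsum s M (fun k => a k - b k) + 2 * hsum s M b.
Proof.
rewrite /hsum !mulr_sumr -big_split; apply: ler_sum => k _ /=.
have := powR_ge0 (1 + k%:~R ^+ 2 : R) s; move: (_ `^ s) => w w0.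
rewrite (_ : _ + _ = w * (2 * nm (a k - b k) ^+ 2 + 2 * nm (b k) ^+ 2)); last by ring.
by rewrite ler_wpM2l// -[X in nm X](subrK (b k)) sqr_nmD.
Qed.

Lemma Hs_norm_ge0 s c : (0 <= Hs_norm s c)%E.
Proof. exact: sqrte_ge0. Qed.

Lemma Re_realM (x : R) (z : R[i]) : Re (x%:C * z) = x * Re z.
Proof. by rewrite Re_mul mul0r subr0. Qed.

Lemma Im_realM (x : R) (z : R[i]) : Im (x%:C * z) = x * Im z.
Proof. by rewrite Im_mul mul0r addr0. Qed.

(** A single term of the sum bounds the coefficient. *)
Lemma Hs_cvg_coef (I : Type) (F : set_system I) (z : I -> int -> R[i]) s k :
  Filter F -> Hs_norm s (z i) @[i --> F] --> 0%E ->
  Re (z i k) @[i --> F] --> 0 /\ Im (z i k) @[i --> F] --> 0.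
Proof.
move=> FF h.
have key e : 0 < e -> \forall i \near F, nm (z i k) < e.
  move=> e0; pose w := Num.sqrt ((1 + k%:~R ^+ 2) `^ s) : R.
  have w0 : 0 < w by rewrite sqrtr_gt0 powR_gt0// sqrp1_gt0.
  have w2 : w ^+ 2 = (1 + k%:~R ^+ 2) `^ s by rewrite sqr_sqrtr// powR_ge0.
  have ew : 0 < w * e / 2 by rewrite divr_gt0 ?mulr_gt0.
  have : nbhs (0%E : \bar R) [set y | (y < (w * e / 2)%:E)%E].
    by apply: open_nbhs_nbhs; split; [exact: open_ereal_lt_ereal|rewrite /= lte_fin].
  move=> /h hF; apply: (@filterS _ F FF _ _ _ hF) => i /= hi.
  have := hsum_le (absz k) (ltW ew) (ltW hi).
  have kk : k \in zs (absz k) by rewrite mem_zs.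
  move/(le_trans (hsum_ge_term s (z i) kk)); rewrite -w2 -exprMn.
  have n0 : 0 <= w * nm (z i k) by rewrite mulr_ge0 ?nm_ge0// ltW.
  rewrite ler_pXn2r ?nnegrE ?n0 ?(ltW ew)// => hw.
  rewrite -(ltr_pM2l w0); apply: le_lt_trans hw _.
  by rewrite ltr_pdivrMr// ltr_pMr ?mulr_gt0// ltr1n.
split; apply/cvgrPdist_lt => e /key kF; apply: (@filterS _ F FF _ _ _ kF) => i.
  by rewrite sub0r normrN; apply: le_lt_trans; exact: Re_le_nm.
by rewrite sub0r normrN; apply: le_lt_trans; exact: Im_le_nm.
Qed.

End SobolevNorm.

Section Solution.
Variable R : realType.
Local Notation nm := (@Normc.normc R).
Local Notation Re := complex.Re.
Local Notation Im := complex.Im.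
Local Notation mu0 := (@lebesgue_measure R).

Lemma sobolev_intg s (v : R -> R) : sobolev s (rc v) ->
  mu0.-integrable (@Ipi R) (EFin \o v).
Proof. by case=> _ + _; exact: L2_intg. Qed.

Variables (mu T : R) (u0 : R -> R) (u : R -> R -> R) (n : nat).
Hypothesis T0 : 0 < T.
Hypothesis hu : kdv_solution mu T u0 u.
Let c t := fourier_coef (rc (u t)).

Let uH t : t \in `[0, T] -> sobolev mu (rc (u t)).
Proof. by case: hu => _ h _ _ _; exact: h. Qed.

Lemma solution_coefB s t k : s \in `[0, T] -> t \in `[0, T] ->
  fourier_coef (rc (fun x => u s x - u t x)) k = c s k - c t k.
Proof.
by move=> sT tT; rewrite fourier_coefB//; [exact: sobolev_intg (uH sT)|exact: sobolev_intg (uH tT)].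
Qed.

Lemma solution_coef_conj t k : t \in `[0, T] -> c t (- k) = conjc (c t k).
Proof. by move=> tT; apply: fourier_coef_conj; exact: sobolev_intg (uH tT). Qed.

(** Continuity into [H^mu] bounds the norm locally, hence uniformly on the
    compact interval. *)
Lemma solution_bounded : n%:R <= mu ->
  exists B : R, forall t, t \in `[0, T] -> forall M, sob n M (c t) <= B.
Proof.
move=> nmu.
have : \forall B \near +oo, `[0, T]%classic `<=`
    (fun t => t \in `[0, T] -> forall M, hsum mu M (c t) <= B).
  have : near_covering (`[0, T]%classic : set R).
    by apply/compact_near_coveringP; exact: segment_compact.
  move=> /(_ R (pinfty_nbhs R) (fun B t => t \in `[0, T] -> forall M, hsum mu M (c t) <= B)).
  apply => t /= tT.
  have [_ _ nt] := uH tT.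
  have ntfin : sobolev_norm mu (rc (u t)) \is a fin_num.
    by rewrite ge0_fin_numE ?Hs_norm_ge0.
  pose b := fine (sobolev_norm mu (rc (u t))).
  have b0 : 0 <= b by rewrite fine_ge0 ?Hs_norm_ge0.
  have hb M : hsum mu M (c t) <= b ^+ 2.
    by apply: hsum_le => //; rewrite fineK// lexx.
  have near1 : \forall s \near t, s \in `[0, T] ->
      (sobolev_norm mu (rc (fun x => (u s x - u t x)%R)) < 1%:E)%E.
    case: hu => _ _ hc _ _; have := hc t tT.
    have : nbhs (0%E : \bar R) [set y | (y < 1%:E)%E].
      by apply: open_nbhs_nbhs; split; [exact: open_ereal_lt_ereal|rewrite /= lte_fin].
    by move=> h1 /(_ _ h1).
  exists ([set s | s \in `[0, T] -> (sobolev_norm mu (rc (fun x => (u s x - u t x)%R)) < 1%:E)%E],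
      [set B | 2 + 2 * b ^+ 2 <= B]) => /=.
    by split => //; apply: nbhs_pinfty_ge; exact: num_real.
  (* The difference has norm less than 1, and [hsumB_le] doubles squares. *)
  move=> [s B] /= [h1 h2] sT M.
  have := hsum_le M ler01 (ltW (h1 sT)); rewrite expr1n => h3.
  apply: le_trans h2; apply: le_trans (hsumB_le mu M (c s) (c t)) _.
  apply: lerD; last by rewrite ler_wpM2l.
  rewrite -[leRHS]mulr1 ler_wpM2l//; apply: le_trans h3.
  rewrite le_eqVlt; apply/orP; left; apply/eqP; apply: eq_bigr => k _.
  by rewrite solution_coefB.
move=> [B [_ hB]]; exists (B + 1) => t tT M.
apply: le_trans (sob_le_hsum M (c t) nmu) _.
by apply: (hB (B + 1)) => //; rewrite ltrDl.
Qed.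

Lemma solution_init k : c 0 k = fourier_coef (rc u0) k.
Proof.
have [h0 _ _ ae0 _] := hu.
have z0T : (0 : R) \in `[0, T] by rewrite in_itv/= lexx ltW.
have i1 := sobolev_intg (uH z0T); have i0 := sobolev_intg h0.
have c1 := cintg_expik_rc (- k) i1; have c0 := cintg_expik_rc (- k) i0.
rewrite /c /fourier_coef; congr (_ * _); rewrite /cintegral.
congr (_ +i* _); congr fine; apply: ae_eq_integral.
- exact: measurable_Ipi.
- exact: measurable_int c1.1.
- exact: measurable_int c0.1.
- apply: (@filterS _ _ (ae_filter_ringOfSetsType mu0) _ _ _ ae0) => x h _.
  by rewrite /rc h.
- exact: measurable_Ipi.
- exact: measurable_int c1.2.
- exact: measurable_int c0.2.
- apply: (@filterS _ _ (ae_filter_ringOfSetsType mu0) _ _ _ ae0) => x h _.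
  by rewrite /rc h.
Qed.

(** The equation in [H^(mu - 3)], read on each coefficient. *)
Lemma solution_dt (B : R) t : t \in `[0, T] ->
  (forall M, \sum_(k <- zs M) (1 + `|k%:~R|) * nm (c t k) <= B) ->
  exists d : int -> R[i],
    (forall k, cvgc (fun M => conv M (c t) (dxc (c t)) k) (d k)) /\
    (forall k, has_dtc T (fun s => c s k) t (airy (c t) k - d k)).
Proof.
move=> tT cB; have [_ _ _ _ /(_ t tT)[ut [ux [[_ hdt] hux heq]]]] := hu.
have u2 : L2 (rc (u t)) by case: (uH tT).
exists (fourier_coef (rc (fun x => u t x * ux x))); split=> k.
  exact: nonlinear_coef_cvg u2 hux cB.
have -> : airy (c t) k - fourier_coef (rc (fun x => u t x * ux x)) k = ut k.
  by apply: (addIr (fourier_coef (rc (fun x => u t x * ux x)) k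
    + dxc (dxc (dxc (c t))) k)); rewrite !addrA heq /airy; ring.
have [hR hI] := Hs_cvg_coef k (tnear_filter T t) hdt.
have cst_cvg (a : R) : cst a x @[x --> tnear T t] --> a.
  exact: (@cvg_cst _ _ _ _ (tnear_filter T t)).
split.
  have := @cvgD _ _ _ _ (tnear_filter T t) _ _ _ _ hR (cst_cvg (Re (ut k))).
  rewrite add0r; apply: tnear_eq_cvg => s sT st.
  rewrite /c /cst; cbv beta.
  by rewrite Re_add Re_opp Re_realM Re_add Re_opp subrK.
have := @cvgD _ _ _ _ (tnear_filter T t) _ _ _ _ hI (cst_cvg (Im (ut k))).
rewrite add0r; apply: tnear_eq_cvg => s sT st.
rewrite /c /cst; cbv beta.
by rewrite Im_add Im_opp Im_realM Im_add Im_opp subrK.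
Qed.

End Solution.

(** * The error estimate *)

Section Error.
Variable R : realType.
Local Notation nm := (@Normc.normc R).
Local Notation Re := complex.Re.
Local Notation Im := complex.Im.
Implicit Types (a c th : int -> R[i]) (k : int).

(** The square of the [L^2] norm, up to the factor [2 pi]. *)
Definition energy N th : R := \sum_(k <- zs N) nm (th k) ^+ 2.

Lemma energy_ge0 N th : 0 <= energy N th.
Proof. by apply: sumr_ge0 => k _; exact: sqr_ge0. Qed.

(** The inverse inequality for trigonometric polynomials of degree [N]. *)
Lemma sob_energy m N th : sob m N th <= (1 + N%:R ^+ 2) ^+ m * energy N th.
Proof.
rewrite /sob /energy mulr_sumr big_seq [leRHS]big_seq; apply: ler_sum => k.
rewrite mem_zs => kN; rewrite ler_wpM2r ?sqr_ge0// lerXn2r ?nnegrE ?addr_ge0 ?sqr_ge0//.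
rewrite lerD2l -[k%:~R ^+ 2]real_normK ?num_real// lerXn2r ?nnegrE//.
by rewrite -intr_norm -[leRHS]/((N%:Z)%:~R) ler_int; lia.
Qed.

(** The summand vanishes unless [|k| > N], where
    [(1 + N^2)^(n - 1) <= (1 + k^2)^(n - 1)]. *)
Lemma high_frequencies n N M c : (0 < n)%N ->
  (1 + N%:R ^+ 2) ^+ n.-1 *
    (\sum_(k <- zs M) (1 + k%:~R ^+ 2) * nm (c k - cut N c k) ^+ 2) <= sob n M c.
Proof.
case: n => // n _; rewrite mulr_sumr; apply: ler_sum => k _ /=.
rewrite /cut; case: ifPn => kN.
  by rewrite subrr Normc.normc0 expr0n !mulr0 sob_term_ge0.
rewrite subr0 mulrA [_ ^+ n.+1]exprSr ler_wpM2r ?sqr_ge0// ler_wpM2r ?(ltW (sqrp1_gt0 _ _))//.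
rewrite lerXn2r ?nnegrE ?addr_ge0 ?sqr_ge0//.
rewrite lerD2l -[k%:~R ^+ 2]real_normK ?num_real// lerXn2r ?nnegrE//.
by rewrite -intr_norm -[leLHS]/((N%:Z)%:~R) ler_int; lia.
Qed.

Lemma energy_has_dt (T t : R) N (th : R -> int -> R[i]) (d : int -> R[i]) :
  (forall k, has_dtc T (fun s => th s k) t (d k)) ->
  has_dt T (fun s => energy N (th s)) t
    (2 * Re (\sum_(k <- zs N) d k * conjc (th t k))).
Proof.
move=> hd; rewrite Re_sum mulr_sumr; apply: has_dt_sum => k.
have [h1 h2] := hd k; have := has_dtD (has_dtM h1 h1) (has_dtM h2 h2).
rewrite (_ : _ + _ = 2 * Re (d k * conjc (th t k))).
  by apply: has_dt_eq' => s; rewrite sqr_nm !expr2.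
by rewrite Re_mul; case: (th t k) => x y /=; ring.
Qed.

Lemma airyB a c k : airy a k - airy c k = airy (fun k => a k - c k) k.
Proof. by rewrite /airy /dxc; ring. Qed.

(** The dispersive term is skew-adjoint. *)
Lemma Re_airy th k : Re (airy th k * conjc (th k)) = 0.
Proof. by rewrite /airy /dxc; case: (th k) => x y /=; ring. Qed.

Lemma cvgc_Re_le (z : nat -> R[i]) w (C : R) N : cvgc z w ->
  (forall M, (N <= M)%N -> nm (z M) <= C) -> `|Re w| <= C.
Proof.
move=> [h _] zC.
have hn : `|Re (z n)| @[n --> \oo] --> `|Re w| by exact: cvg_norm.
rewrite -(cvg_lim _ hn)//; apply: limr_le; first by apply/cvg_ex; eexists; exact: hn.
have : \forall n \near \oo, (N <= n)%N by exact: nbhs_infty_ge.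
by apply: filterS => M /zC; apply: le_trans; exact: Re_le_nm.
Qed.

(** The dispersive terms cancel, and the nonlinear ones are those of
    [nonlinear_error], uniformly in the truncation [M] of the exact nonlinear
    term; the bound passes to the limit. *)
Lemma energy_ineq N a c d (K dl : R) :
  (forall k, a (- k) = conjc (a k)) -> (forall k, c (- k) = conjc (c k)) ->
  (forall k, cvgc (fun M => conv M c (dxc c) k) (d k)) ->
  (forall M, \sum_(k <- zs M) (1 + `|k%:~R|) * nm (c k) <= K) ->
  (forall M, \sum_(k <- zs M) (1 + k%:~R ^+ 2) * nm (c k - cut N c k) ^+ 2 <= dl) ->
  2 * Re (\sum_(k <- zs N) (airy a k + burgers N a a k - (airy c k - d k)) *
    conjc (a k - c k)) <=
  3 * K * energy N (fun k => a k - c k) + K * dl.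
Proof.
move=> ac cc cd cK cdl; pose th k := a k - c k.
pose z M := \sum_(k <- zs N) (conv M c (dxc c) k - dxc (conv N a a) k / 2) * conjc (th k).
pose w := \sum_(k <- zs N) (d k - dxc (conv N a a) k / 2) * conjc (th k).
have zw : cvgc z w.
  apply: cvgc_sum => k; apply: cvgcM; last exact: cvgc_cst.
  have [h1 h2] := cd k; split.
    rewrite Re_add; under eq_fun do rewrite Re_add.
    by apply: cvgD => //; exact: cvg_cst.
  rewrite Im_add; under eq_fun do rewrite Im_add.
  by apply: cvgD => //; exact: cvg_cst.
have zC M : (N <= M)%N -> nm (z M) <= (3 * K * energy N th + K * dl) / 2.
  move=> NM; rewrite ler_pdivlMr// mulrC.
  have := nonlinear_error a NM (cK M) (cdl M); cbv zeta.
  have -> : energy N th = \sum_(k <- zs N) nm (cut N th k) ^+ 2.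
    rewrite /energy big_seq [RHS]big_seq; apply: eq_bigr => k.
    by rewrite mem_zs /cut => ->.
  apply: le_trans; set S := \sum_(k <- zs N) _.
  have -> : S = 2 * 'i * z M.
    rewrite /z mulr_sumr /S big_seq [RHS]big_seq; apply: eq_bigr => k.
    rewrite mem_zs /cut abszN => kN; rewrite kN conv_dxc /dxc.
    have -> : a (- k) - c (- k) = conjc (th k) by rewrite ac cc -rmorphB.
    move: (conjc (th k)) (conv M c c k) (conv N a a k) => t1 t2 t3.
    have -> : 0 +i* k%:~R = 'i * k%:~R :> R[i].
      by rewrite real_complex_int; apply: complex_eq => /=; ring.
    have i2 : 'i * 'i = -1 :> R[i].
      by apply: complex_eq => /=; ring.
    have hf (x y z0 : R[i]) : 2 * 'i * (('i * k%:~R * x / 2 - 'i * k%:~R * y / 2) * z0) =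
        ('i * 'i) * (k%:~R * (x - y) * z0).
      by field.
    by rewrite hf i2; ring.
  rewrite !Normc.normcM; have -> : nm 'i = 1 by rewrite nm_imag normr1.
  have n2 : nm 2 = 2.
    by apply: etrans (nm_int R 2) _; rewrite ger0_norm// ler0z.
  by rewrite mulr1 n2.
have -> : \sum_(k <- zs N) (airy a k + burgers N a a k - (airy c k - d k)) *
    conjc (a k - c k) = \sum_(k <- zs N) airy th k * conjc (th k) + w.
  rewrite /w -big_split big_seq [RHS]big_seq; apply: eq_bigr => k.
  rewrite mem_zs => kN /=; rewrite /burgers /cut kN -mulrDl; congr (_ * _).
  by rewrite /th -airyB; ring.
rewrite Re_add Re_sum big1 => [|k _]; last exact: Re_airy.
rewrite add0r; have := cvgc_Re_le zw zC; move/(le_trans (ler_norm _)).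
by rewrite ler_pdivlMr// mulrC.
Qed.

Variables (mu T : R) (u0 : R -> R) (u : R -> R -> R) (uN : nat -> R -> R -> R).
Hypothesis T0 : 0 < T.
Hypothesis hu : kdv_solution mu T u0 u.
Hypothesis huN : forall N : nat, (1 <= N)%N -> galerkin N T u0 (uN N).
Let c t := fourier_coef (rc (u t)).
Let a N t := fourier_coef (rc (uN N t)).

Lemma galerkin_coef_conj N t k : (1 <= N)%N -> t \in `[0, T] -> a N t (- k) = conjc (a N t k).
Proof.
move=> N1 tT; apply: fourier_coef_conj.
have [aE _ _ _] := galerkin_coef T0 (huN N1).
by have [+ _] := cintg_trig N (a N t); rewrite -aE.
Qed.

(** Gronwall's inequality with forcing [high_frequencies]: initially the
    coefficients agree up to frequency [N]. *)
Lemma galerkin_error n : (2 <= n)%N -> n%:R <= mu ->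
  exists C : R, forall N (t : R), (1 <= N)%N -> t \in `[0, T] ->
    (1 + N%:R ^+ 2) ^+ n.-1 * energy N (fun k => a N t k - c t k) <= C.
Proof.
move=> n2 nmu; have [B cB] := solution_bounded hu nmu.
have B0 : 0 <= B.
  have z0T : (0 : R) \in `[0, T] by rewrite in_itv/= lexx ltW.
  exact: le_trans (sob_ge0 _ _ _) (cB 0 z0T 0%N).
pose K := B + 4; have K0 : 0 <= K by rewrite addr_ge0.
have cK (t : R) M : t \in `[0, T] -> \sum_(k <- zs M) (1 + `|k%:~R|) * nm (c t k) <= K.
  move=> tT; apply: le_trans (sum_dnm_le _ _) _; rewrite lerD2r.
  exact: le_trans (sob_le _ _ n2) (cB t tT M).
exists (K * B * T * expR (3 * K * T)) => N t N1 tT.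
pose W : R := (1 + N%:R ^+ 2) ^+ n.-1.
have W0 : 0 < W by rewrite exprn_gt0// ltr_pwDl ?sqr_ge0.
have cdl (s : R) M : s \in `[0, T] ->
    \sum_(k <- zs M) (1 + k%:~R ^+ 2) * nm (c s k - cut N (c s) k) ^+ 2 <= B / W.
  move=> sT; rewrite ler_pdivlMr// mulrC.
  by apply: le_trans (high_frequencies _ _ _ _) (cB s sT M); exact: ltnW.
have [aE a0 ai ad] := galerkin_coef T0 (huN N1).
pose E s := energy N (fun k => a N s k - c s k).
have hE (s : R) : s \in `[0, T] -> exists E', has_dt T E s E' /\ E' <= 3 * K * E s + K * (B / W).
  move=> sT; have [d [cd dc]] := solution_dt hu sT (fun M => cK s M sT).
  have dth k : has_dtc T (fun r => a N r k - c r k) s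
      (airy (a N s) k + burgers N (a N s) (a N s) k - (airy (c s) k - d k)).
    by apply: has_dtcB; [exact: ad|exact: dc].
  have := @energy_has_dt T s N _ _ dth; set E' := 2 * _ => hE'.
  exists E'; split => //.
  apply: energy_ineq => //.
  - by move=> k; exact: galerkin_coef_conj.
  - by move=> k; exact: (solution_coef_conj hu).
  - by move=> M; exact: cK.
  - by move=> M; exact: cdl.
pose E' s := if pselect (s \in `[0, T]) is left h then projT1 (cid (hE s h)) else 0.
have E'P (s : R) : s \in `[0, T] -> has_dt T E s (E' s) /\ E' s <= 3 * K * E s + K * (B / W).
  by move=> sT; rewrite /E'; case: pselect => // h; case: cid.
have E00 : E 0 = 0.
  rewrite /E /energy big_seq big1 // => k; rewrite mem_zs => kN.
  by rewrite /a ai /c (solution_init T0 hu) /cut kN subrr Normc.normc0 expr0n.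
have := @gronwall R T E E' (3 * K) (K * (B / W)) _ _ E00 (fun s sT => (E'P s sT).1)
  (fun s sT => (E'P s sT).2) t tT.
rewrite !mulr_ge0 ?invr_ge0 ?(ltW W0)// => /(_ isT isT) h.
rewrite -/W -ler_pdivlMl//; apply: le_trans h _.
rewrite le_eqVlt; apply/orP; left; apply/eqP; field.
by rewrite gt_eqF.
Qed.

(** The inverse inequality on trigonometric polynomials of degree [N] turns
    the [L^2] error estimate into a bound in [H^m]. *)
Lemma galerkin_sob_bounded m : (m.+1)%:R <= mu -> 2 <= mu ->
  exists C : R, forall N (t : R), (1 <= N)%N -> t \in `[0, T] -> sob m N (a N t) <= C.
Proof.
move=> mmu mu2; pose n := maxn 2 m.+1.
have nmu : n%:R <= mu by rewrite /n; case: leqP.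
have [C1 hC1] := galerkin_error (leq_maxl 2 m.+1) nmu.
have [B cB] := solution_bounded hu nmu.
exists (2 * C1 + 2 * B) => N t N1 tT.
rewrite (_ : a N t = (fun k => (a N t k - c t k) + c t k)); last first.
  by apply/funext => k; rewrite subrK.
apply: le_trans (sobD _ _ _ _) _; apply: lerD; rewrite ler_wpM2l//.
  apply: le_trans (sob_energy _ _ _) _; apply: le_trans (hC1 N t N1 tT).
  rewrite ler_wpM2r ?energy_ge0// ler_weXn2l// ?lerDl ?sqr_ge0//.
  by rewrite /n; lia.
apply: le_trans (sob_le _ _ _) (cB t tT N); rewrite /n; lia.
Qed.

End Error.

(** * Time derivatives of the Galerkin approximation *)

(** The time derivatives of the coefficients are polynomial expressions in the
    coefficients themselves; the syntax records their structure uniformly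
    in [N]. *)
Inductive flow : Type :=
| Sol
| Sum of flow & flow
| Airy of flow
| Burgers of flow & flow.

Fixpoint flow_diff (e : flow) : flow :=
  match e with
  | Sol => Sum (Airy Sol) (Burgers Sol Sol)
  | Sum e1 e2 => Sum (flow_diff e1) (flow_diff e2)
  | Airy e1 => Airy (flow_diff e1)
  | Burgers e1 e2 => Sum (Burgers (flow_diff e1) e2) (Burgers e1 (flow_diff e2))
  end.

(** The number of space derivatives of the solution that the expression needs. *)
Fixpoint flow_order (e : flow) : nat :=
  match e with
  | Sol => 0
  | Sum e1 e2 => maxn (flow_order e1) (flow_order e2)
  | Airy e1 => flow_order e1 + 3
  | Burgers e1 e2 => maxn (flow_order e1) (flow_order e2) + 1
  end.

Lemma flow_order_diff e : (flow_order (flow_diff e) <= flow_order e + 3)%N.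
Proof. by elim: e => [|e1 h1 e2 h2|e1 h1|e1 h1 e2 h2] //=; lia. Qed.

Lemma flow_order_iter j : (flow_order (iter j flow_diff Sol) <= 3 * j)%N.
Proof.
elim: j => [//|j IH]; rewrite iterS; apply: leq_trans (flow_order_diff _) _; lia.
Qed.

Section Flow.
Variable R : realType.
Local Notation nm := (@Normc.normc R).
Implicit Types (a b c : int -> R[i]) (k : int) (e : flow).

Fixpoint flow_eval N a e : int -> R[i] :=
  match e with
  | Sol => a
  | Sum e1 e2 => fun k => flow_eval N a e1 k + flow_eval N a e2 k
  | Airy e1 => airy (flow_eval N a e1)
  | Burgers e1 e2 => burgers N (flow_eval N a e1) (flow_eval N a e2)
  end.

Lemma has_dtc_airy (T t : R) (b : R -> int -> R[i]) (d : int -> R[i]) k :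
  (forall k, has_dtc T (fun s => b s k) t (d k)) ->
  has_dtc T (fun s => airy (b s) k) t (airy d k).
Proof.
move=> h; rewrite /airy -mulN1r.
rewrite (_ : (fun s => _) = (fun s => -1 * dxc (dxc (dxc (b s))) k)).
  by do 4!apply: has_dtcZ; exact: h.
by apply/funext => s; rewrite mulN1r.
Qed.

Lemma has_dtc_burgers (T t : R) N (b c : R -> int -> R[i]) (d e : int -> R[i]) k :
  (forall k, has_dtc T (fun s => b s k) t (d k)) ->
  (forall k, has_dtc T (fun s => c s k) t (e k)) ->
  has_dtc T (fun s => burgers N (b s) (c s) k) t
    (burgers N d (c t) k + burgers N (b t) e k).
Proof.
move=> hb hc; rewrite /burgers /cut; case: ifP => _; last first.
  by rewrite addr0; exact: has_dtc_cst.
pose z : R[i] := - ((0 +i* k%:~R) / 2).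
rewrite (_ : (fun s => _) = (fun s => z * conv N (b s) (c s) k)); last first.
  by apply/funext => s; rewrite /dxc /z; ring.
rewrite (_ : _ + _ = z * (conv N d (c t) k + conv N (b t) e k)); last first.
  by rewrite /dxc /z; ring.
apply: has_dtcZ; rewrite /conv -big_split; apply: has_dtc_sum => p /=.
rewrite -big_split; apply: has_dtc_sum => q /=; rewrite -mulrnDl.
by apply: has_dtcMn; exact: has_dtcM.
Qed.

Lemma flow_eval_has_dtc (T t : R) N (a : R -> int -> R[i]) e :
  (forall k, has_dtc T (fun s => a s k) t (airy (a t) k + burgers N (a t) (a t) k)) ->
  forall k, has_dtc T (fun s => flow_eval N (a s) e k) t (flow_eval N (a t) (flow_diff e) k).
Proof.
move=> ha; elim: e => [|e1 h1 e2 h2|e1 h1|e1 h1 e2 h2] k //=.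
- exact: has_dtcD.
- exact: has_dtc_airy.
- exact: has_dtc_burgers.
Qed.

Lemma sob_airy l N b : sob l N (airy b) <= sob (l + 3) N b.
Proof.
apply: ler_sum => k _; rewrite exprD -mulrA ler_wpM2l ?exprn_ge0 ?(ltW (sqrp1_gt0 _ _))//.
rewrite /airy normcN /dxc !Normc.normcM !nm_imag.
rewrite (_ : (_ * _) ^+ 2 = (`|k%:~R| ^+ 2) ^+ 3 * nm (b k) ^+ 2); last by ring.
rewrite real_normK ?num_real// ler_wpM2r ?sqr_ge0//.
by rewrite lerXn2r ?nnegrE ?sqr_ge0 ?addr_ge0 ?sqr_ge0// lerDr.
Qed.

Lemma sob_burgers l N b c : sob l N (burgers N b c) <= sob l.+1 N (conv N b c).
Proof.
apply: ler_sum => k _; rewrite [(_ ^+ l.+1)]exprSr -mulrA.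
rewrite ler_wpM2l ?exprn_ge0 ?(ltW (sqrp1_gt0 _ _))//.
rewrite /burgers /cut; case: ifP => _; last first.
  by rewrite Normc.normc0 expr0n mulr_ge0 ?sqr_ge0// ltW ?sqrp1_gt0.
rewrite normcN /dxc !Normc.normcM nm_imag Normc.normcV !exprMn.
have -> : nm 2 = 2 by apply: etrans (nm_int R 2) _; rewrite ger0_norm// ler0z.
rewrite real_normK ?num_real// mulrAC ler_wpM2r ?sqr_ge0//.
by have := sqr_ge0 (k%:~R : R); move: (_ ^+ 2) => x x0; lra.
Qed.

Lemma sob_burgers_le l N b c (B C : R) : sob l.+1 N b <= B -> sob l.+1 N c <= C ->
  sob l N (burgers N b c) <=
  2 * 8 ^+ l.+1 * (((C + 8) / 2) ^+ 2 * B + ((B + 8) / 2) ^+ 2 * C).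
Proof.
move=> bB cC; apply: le_trans (sob_burgers _ _ _ _) _; apply: le_trans (sob_conv _ _ _ _) _.
have nB (z : int -> R[i]) (D : R) : sob l.+1 N z <= D ->
    (\sum_(k <- zs N) nm (z k)) ^+ 2 <= ((D + 8) / 2) ^+ 2.
  move=> zD; have D0 : 0 <= D by exact: le_trans (sob_ge0 _ _ _) zD.
  rewrite lerXn2r ?nnegrE ?divr_ge0 ?addr_ge0 ?sumr_ge0// => [k _|].
    exact: nm_ge0.
  apply: le_trans (sum_nm_le _ _) _; rewrite ler_pM2r ?invr_gt0// lerD2r.
  exact: le_trans (sob_le _ _ (ltn0Sn l)) zD.
rewrite ler_wpM2l ?mulr_ge0 ?exprn_ge0//; apply: lerD; apply: ler_pM;
  rewrite ?sqr_ge0 ?sob_ge0//; exact: nB.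
Qed.

(** [Airy] loses three derivatives, and [Burgers] only one because [H^(l + 1)] is
    an algebra. *)
Lemma flow_eval_bounded (I : Type) (N : I -> nat) (a : I -> int -> R[i]) m (C : R) e l :
  (forall i, sob m (N i) (a i) <= C) -> (l + flow_order e <= m)%N ->
  exists D : R, forall i, sob l (N i) (flow_eval (N i) (a i) e) <= D.
Proof.
move=> aC; elim: e l => [|e1 h1 e2 h2|e1 h1|e1 h1 e2 h2] l /= lm.
- by exists C => i; apply: le_trans (sob_le _ _ _) (aC i); lia.
- have [|D1 hD1] := h1 l; first by lia.
  have [|D2 hD2] := h2 l; first by lia.
  exists (2 * D1 + 2 * D2) => i; apply: le_trans (sobD _ _ _ _) _.
  by apply: lerD; rewrite ler_wpM2l.
- have [|D1 hD1] := h1 (l + 3)%N; first by lia.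
  by exists D1 => i; apply: le_trans (sob_airy _ _ _) (hD1 i).
- have [|D1 hD1] := h1 l.+1; first by lia.
  have [|D2 hD2] := h2 l.+1; first by lia.
  by eexists => i; exact: sob_burgers_le (hD1 i) (hD2 i).
Qed.

Lemma sobolev_norm_trig l N b :
  sobolev_norm l%:R (trig N b) = (Num.sqrt (sob l N b))%:E.
Proof.
rewrite /sobolev_norm /Hs_norm.
transitivity (sqrte (sob l N b)%:E) => //; congr sqrte.
rewrite (eq_esum (b := fun k => if k \in [set` zs N] then
    ((1 + k%:~R ^+ 2) ^+ l * nm (b k) ^+ 2)%:E else 0%E)).
  have ge0 k : k \in [set` zs N] -> (0 <= ((1 + k%:~R ^+ 2) ^+ l * nm (b k) ^+ 2)%:E)%E.
    by move=> _; rewrite lee_fin sob_term_ge0.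
  rewrite -esum_mkcond (esum_fset (finite_seq _) ge0).
  rewrite -fsbig_seq ?uniq_zs// /sob; elim: (zs N) => [|k r IH].
    by rewrite !big_nil.
  by rewrite !big_cons EFinD IH.
move=> k _; rewrite fourier_coef_trig mem_setE /= mem_zs /cut.
rewrite powR_mulrn ?(ltW (sqrp1_gt0 _ _))//.
by case: ifP => // _; rewrite Normc.normc0 expr0n mulr0.
Qed.

End Flow.

Unset Implicit Arguments.
Local Close Scope classical_set_scope.
Local Close Scope complex_scope.

Theorem proposition3p2 (R : realType) (T mu : R) (u0 : R -> R)
    (u : R -> R -> R) (uN : nat -> R -> R -> R) (j l : nat)
    (hT : 0 < T)
    (hu : kdv_solution mu T u0 u)
    (huN : forall N : nat, (1 <= N)%N -> galerkin N T u0 (uN N))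
    (hmu : Num.max 2 ((3 * j + l + 1)%:R) <= mu) :
  exists C : R, forall N : nat, (1 <= N)%N ->
    forall t : R, t \in `[0, T] ->
      (sobolev_norm l%:R (rc (iter j (dt T) (uN N) t)) <= C%:E)%E.
Proof.
move: hmu; rewrite ge_max addn1 => /andP[mu2 mum].
have [C hC] := galerkin_sob_bounded hT hu huN mum mu2.
pose I := {p : nat * R | (1 <= p.1)%N /\ p.2 \in `[0, T]}.
pose a (N : nat) (t : R) := fourier_coef (rc (uN N t)).
have iC (i : I) : sob (3 * j + l) (sval i).1 (a (sval i).1 (sval i).2) <= C.
  by case: i => -[N t] /= [N1 tT]; exact: hC.
have [|D hD] := flow_eval_bounded (e := iter j flow_diff Sol) (l := l) iC.
  by have := flow_order_iter j; lia.
exists (Num.sqrt D) => N N1 t tT.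
have [aE _ _ ad] := galerkin_coef hT (huN N N1).
have dtE i s : s \in `[0, T] ->
    rc (iter i (dt T) (uN N) s) = trig N (flow_eval N (a N s) (iter i flow_diff Sol)).
  elim: i s => [|i IH] s sT; first exact: aE.
  rewrite !iterS; apply: (dt_trig hT sT IH) => k _.
  by apply: flow_eval_has_dtc => l'; exact: ad.
rewrite dtE// sobolev_norm_trig lee_fin ler_wsqrtr//.
exact: (hD (exist _ (N, t) (conj N1 tT))).
Qed.
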